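(* Let $\Sigma$ be any rational complete fan in $\mathbb{R}^3$. Then there is a unimodular fan $\Sigma'$ that refines $\Sigma$ and such that $\Sigma'$ is not the blow-up of any unimodular fan. If $\Sigma$ is polytopal, then $\Sigma'$ can be chosen to be polytopal too.
   Context: A polyhedral cone is the set $\mathrm{Cone}\{v_1,\dots,v_m\}$ of nonnegative linear combinations of finitely many vectors. A fan in $\mathbb{R}^n$ is a finite collection of polyhedral cones closed under taking faces and such that any two of its cones intersect in a common face of both. A fan is: complete if the union of its cones is the whole space; rational if the linear span of every cone is a rational subspace; simplicial if every cone is generated by linearly independent vectors; unimodular if it is rational, simplicial, full-dimensional, and every cone has multiplicity one, i.e. the primitive integer generators of the rays of each cone form part of a $\mathbb{Z}$-basis of $\mathbb{Z}^n$. For complete fans $\Sigma,\Sigma'$ one says that $\Sigma'$ refines $\Sigma$ if every cone of $\Sigma'$ is contained in some cone of $\Sigma$. The normal fan of a polytope $P$ (convex hull of a finite set of points) consists of the cones $\{\alpha : \langle\alpha,p-q\rangle\ge 0 \text{ for all } p\in F, q\in P\}$ for all nonempty faces $F$ of $P$. A complete fan is polytopal if it is the normal fan of some polytope. Stellar subdivision of a fan $\Sigma$ by a nonzero vector $\gamma$ contained in some cone of $\Sigma$: the fan consisting of the cones of $\Sigma$ not containing $\gamma$ together with the cones $\mathrm{Cone}(\{\gamma\}\cup C)$ for all $C\in\Sigma$ with $\gamma\notin C$ such that there is $C'\in\Sigma$ with $C\cup\{\gamma\}\subset C'$. Blow-up: let $C$ be a unimodular simplicial cone of a fan $\Sigma$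 with primitive generators $\alpha_1,\dots,\alpha_k$, $k\ge 2$. The blow-up of $\Sigma$ at $C$ is the stellar subdivision of $\Sigma$ by $\gamma=\sum_{i=1}^k\alpha_i$. A fan is a blow-up of $\Sigma$ if it is the blow-up of $\Sigma$ at some such cone. *)

(* Defs.v *)
From HB Require Import structures.
From mathcomp Require Import all_boot all_order all_algebra.
From mathcomp Require Import boolp classical_sets functions cardinality reals.

Set Implicit Arguments.
Unset Strict Implicit.
Unset Printing Implicit Defensive.

Import Order.TTheory GRing.Theory Num.Theory.
Local Open Scope classical_set_scope.
Local Open Scope ring_scope.

Section Fans.
Variables (R : realType) (n : nat).

Local Notation V := 'rV[R]_n.
Local Notation Z := 'rV[int]_n.

Implicit Types (A C D F P : set V) (Sigma : set (set V)).

Definition dot (x y : V) : R := \sum_j x 0 j * y 0 j.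

Definition of_int (u : Z) : V := map_mx intr u.
Definition of_rat (u : 'rV[rat]_n) : V := map_mx ratr u.

(* The generating set A may be infinite, as is needed for Cone({gamma} U C). *)
Definition Cone A : set V :=
  [set x | exists (m : nat) (v : 'I_m -> V) (c : 'I_m -> R),
     [/\ forall i, A (v i), forall i, 0 <= c i & x = \sum_i c i *: v i]].

Definition conv_hull A : set V :=
  [set x | exists (m : nat) (v : 'I_m -> V) (c : 'I_m -> R),
     [/\ forall i, A (v i), forall i, 0 <= c i, \sum_i c i = 1
       & x = \sum_i c i *: v i]].

Definition lin_span A : set V :=
  smallest [set W | exists U : {vspace V}, W = [set` U]] A.

Definition polyhedral_cone C := exists s : seq V, C = Cone [set` s].

(* Taking a = 0 shows that C is a face of itself. *)
Definition cone_face F C :=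
  exists a : V,
    (forall x, C x -> 0 <= dot a x) /\ F = C `&` [set x | dot a x = 0].

Definition is_fan Sigma :=
  [/\ finite_set Sigma,
      forall C, Sigma C -> polyhedral_cone C,
      forall C F, Sigma C -> cone_face F C -> Sigma F
    & forall C D, Sigma C -> Sigma D ->
        cone_face (C `&` D) C /\ cone_face (C `&` D) D].

Definition complete_fan Sigma := \bigcup_(C in Sigma) C = setT.

Definition rational_subspace (W : set V) :=
  exists s : seq 'rV[rat]_n, W = [set` <<map of_rat s>>%VS].

Definition rational_fan Sigma :=
  forall C, Sigma C -> rational_subspace (lin_span C).

Definition simplicial_cone C := exists s : seq V, free s /\ C = Cone [set` s].

Definition simplicial_fan Sigma := forall C, Sigma C -> simplicial_cone C.

(* Equivalently, Sigma being finite: every maximal cone spans the whole space. *)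
Definition full_dimensional_fan Sigma :=
  forall C, Sigma C -> exists D, [/\ Sigma D, C `<=` D & lin_span D = setT].

Definition primitive (u : Z) := (\big[gcdn/0]_j absz (u ord0 j) = 1)%N.

Definition ray_generator C (u : Z) :=
  primitive u /\ cone_face (Cone [set of_int u]) C.

Definition Z_basis (B : 'M[int]_n) :=
  forall z : Z, exists! c : Z, z = \sum_i c 0 i *: row i B.

Definition part_of_Z_basis (S : set Z) :=
  exists B : 'M[int]_n, Z_basis B /\ forall u, S u -> exists i, u = row i B.

Definition multiplicity_one C := part_of_Z_basis (ray_generator C).

Definition unimodular_fan Sigma :=
  [/\ rational_fan Sigma, simplicial_fan Sigma, full_dimensional_fan Sigma
    & forall C, Sigma C -> multiplicity_one C].

Definition refines Sigma' Sigma :=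
  forall C', Sigma' C' -> exists C, Sigma C /\ C' `<=` C.

(* The face of P on which the functional a is maximal, or the empty face. *)
Definition polytope_face F P :=
  exists (a : V) (b : R),
    (forall x, P x -> dot a x <= b) /\ F = P `&` [set x | dot a x = b].

Definition normal_cone P F : set V :=
  [set a | forall p q, F p -> P q -> 0 <= dot a (p - q)].

Definition normal_fan P : set (set V) :=
  [set C | exists F, [/\ polytope_face F P, F !=set0 & C = normal_cone P F]].

Definition polytopal Sigma :=
  exists s : seq V, Sigma = normal_fan (conv_hull [set` s]).

Definition stellar_subdivision Sigma (g : V) : set (set V) :=
  [set C | Sigma C /\ ~ C g] `|`
  [set D | exists C, [/\ Sigma C, ~ C g,
     exists C', Sigma C' /\ C `|` [set g] `<=` C'
     & D = Cone (g |` C)]].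

(* s lists the primitive generators of the unimodular simplicial cone C. *)
Definition unimodular_cone_gens C (s : seq Z) :=
  [/\ uniq s, forall u, u \in s <-> ray_generator C u,
      C = Cone [set` map of_int s] & part_of_Z_basis [set` s]].

Definition is_blowup Sigma' Sigma :=
  exists (C : set V) (s : seq Z),
    [/\ Sigma C, unimodular_cone_gens C s, (2 <= size s)%N
      & Sigma' = stellar_subdivision Sigma (\sum_(u <- s) of_int u)].

End Fans.

(* Main.v *)
Require Import Defs.
From mathcomp Require Import all_boot all_order all_algebra.
From mathcomp Require Import boolp classical_sets functions cardinality reals.
From mathcomp Require Import zify ring lra.

(** The refinement constructed here is the normal fan of a polytope whatever Sigma
    is, so one construction proves both assertions.

    Polytopality is carried along in a finite list of charts: unimodular cones,
    each with an integer functional, such that the functionals are the linear pieces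
    of a strictly convex support function ([coherent]). Since the cones are
    simplicial, strict convexity amounts to finitely many inequalities between
    integers. If such a list covers the space, the faces of its cones form a
    unimodular fan, and this is the normal fan of the convex hull of the functionals
    ([polytopal_fan_of]). Cutting the cones into smaller ones preserves all this as
    soon as a perturbation of the support function is strictly convex inside each
    old cone ([refine_coherent]).

    To refine Sigma, start from the coordinate orthants. Given an integer
    functional, blow up an edge on whose ends it has opposite signs, with the largest
    possible difference, and repeat; this ends with each cone on one side of the
    hyperplane ([respect_functionals]). Do this for the coordinates and for the
    normals of rational hyperplanes through the lower dimensional cones of Sigma. The
    interior of a cone obtained meets only full dimensional cones of Sigma, and as it
    is connected it lies in one of them ([cone_in_fan]).

    To exclude blow-ups, cut each cone with generators u, v, w once more: into three
    corners such as (u, u + v, u + w) and, in the middle cone spanned by u + v,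
    u + w, v + w, three cones around u + v + w. Suppose that the result is a blow-up,
    with new ray g the sum of a set s. Every member of s is a neighbour of g, and
    every maximal cone at g contains all but one member of s ([blowup_rows]). If g is
    one of the rays u, its neighbours are of the form u + v with v in an orthant
    containing u, and a sum of several of them is larger than u. If g is u + v or u + v + w,
    counting generators u, v, w rules out a sum of several neighbours as well
    ([final_not_blowup]). *)

Set Implicit Arguments.
Unset Strict Implicit.
Unset Printing Implicit Defensive.

Import Order.TTheory GRing.Theory Num.Theory.
Local Open Scope classical_set_scope.
Local Open Scope ring_scope.

(** * Convex cones and convex hulls *)

Section ConvexCones.
Variables (R : realType) (n : nat).
Local Notation V := 'rV[R]_n.
Implicit Types (x y a : V) (A W : set V).

Lemma dotE a x : dot a x = (a *m x^T) 0 0.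
Proof. by rewrite /dot mxE; apply: eq_bigr => j _; rewrite mxE. Qed.

Lemma dotC a x : dot a x = dot x a.
Proof. by apply: eq_bigr => j _; rewrite mulrC. Qed.

Lemma dotDr a x y : dot a (x + y) = dot a x + dot a y.
Proof. by rewrite -big_split; apply: eq_bigr => j _; rewrite mxE mulrDr. Qed.

Lemma dotZr a t x : dot a (t *: x) = t * dot a x.
Proof. by rewrite mulr_sumr; apply: eq_bigr => j _; rewrite mxE mulrCA. Qed.

Lemma dot0r a : dot a 0 = 0.
Proof. by rewrite -(scale0r 0) dotZr mul0r. Qed.

Lemma dotBr a x y : dot a (x - y) = dot a x - dot a y.
Proof. by rewrite dotDr -scaleN1r dotZr mulN1r. Qed.

Lemma dot_sumr a (I : Type) (r : seq I) (P : pred I) (F : I -> V) :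
  dot a (\sum_(i <- r | P i) F i) = \sum_(i <- r | P i) dot a (F i).
Proof. exact: (big_morph (dot a) (dotDr a) (dot0r a)). Qed.

Definition convex_cone W :=
  [/\ W 0, forall x y, W x -> W y -> W (x + y)
    & forall t x, 0 <= t -> W x -> W (t *: x)].

Lemma convex_cone_sum W (I : Type) (r : seq I) (P : pred I) (F : I -> V) :
  convex_cone W -> (forall i, P i -> W (F i)) -> W (\sum_(i <- r | P i) F i).
Proof. by case=> W0 WD _ WF; apply: (big_ind W). Qed.

Lemma convex_cone_Cone A : convex_cone (Cone A).
Proof.
split.
- by exists 0%N, (fun _ => 0), (fun _ => 0); split; [case|case|rewrite big_ord0].
- move=> x y [m1 [v1 [c1 [A1 c1_ge0 ->]]]] [m2 [v2 [c2 [A2 c2_ge0 ->]]]].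
  exists (m1 + m2)%N,
    (fun i : 'I_(m1 + m2) => match fintype.split i with inl j => v1 j | inr j => v2 j end),
    (fun i : 'I_(m1 + m2) => match fintype.split i with inl j => c1 j | inr j => c2 j end).
  split=> [i|i|]; try by case: splitP.
  rewrite big_split_ord; congr (_ + _); apply: eq_bigr => i _.
    by rewrite -/(unsplit (inl i)) unsplitK.
  by rewrite -/(unsplit (inr i)) unsplitK.
- move=> t x t_ge0 [m [v [c [Av c_ge0 ->]]]].
  exists m, v, (fun i => t * c i); split=> // [i|]; first exact: mulr_ge0.
  by rewrite scaler_sumr; apply: eq_bigr => i _; rewrite scalerA.
Qed.

Lemma sub_Cone A : A `<=` Cone A.
Proof.
move=> x Ax; exists 1%N, (fun _ => x), (fun _ => 1).
by split=> //; rewrite big_ord1 scale1r.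
Qed.

Lemma Cone_min A W : convex_cone W -> A `<=` W -> Cone A `<=` W.
Proof.
move=> Wc AW x [m [v [c [Av c_ge0 ->]]]]; apply: (convex_cone_sum _ Wc) => i _.
by case: Wc => _ _; apply => //; exact: AW.
Qed.

Lemma Cone1P g x : Cone [set g] x <-> exists2 t, 0 <= t & x = t *: g.
Proof.
split; last first.
  move=> [t t_ge0 ->]; have [_ _ sc] := convex_cone_Cone [set g].
  by apply: sc => //; exact: sub_Cone.
apply: (Cone_min (W := [set x | exists2 t, 0 <= t & x = t *: g])); last first.
  by move=> _ ->; exists 1; rewrite ?scale1r.
split; first by exists 0; rewrite ?scale0r.
  move=> _ _ [s s_ge0 ->] [t t_ge0 ->]; exists (s + t); first exact: addr_ge0.
  by rewrite scalerDl.
move=> s _ s_ge0 [t t_ge0 ->]; exists (s * t); first exact: mulr_ge0.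
by rewrite scalerA.
Qed.

Lemma Cone_setU1 W g x : convex_cone W -> Cone (g |` W) x ->
  exists t y, [/\ 0 <= t, W y & x = t *: g + y].
Proof.
move=> Wc; have [W0 WD WZ] := Wc.
apply: (Cone_min (W := [set x | exists t y, [/\ 0 <= t, W y & x = t *: g + y]])).
  split; first by exists 0, 0; rewrite scale0r addr0.
    move=> _ _ [s [y [s_ge0 Wy ->]]] [t [z [t_ge0 Wz ->]]].
    exists (s + t), (y + z); split; [exact: addr_ge0|exact: WD|].
    by rewrite scalerDl addrACA.
  move=> s _ s_ge0 [t [z [t_ge0 Wz ->]]].
  exists (s * t), (s *: z); split; [exact: mulr_ge0|exact: WZ|].
  by rewrite scalerDr scalerA.
move=> z [->|Wz]; first by exists 1, 0; rewrite scale1r addr0.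
by exists 0, z; rewrite scale0r add0r.
Qed.

Lemma conv_hull_le A a b p :
  (forall q, A q -> dot a q <= b) -> conv_hull A p -> dot a p <= b.
Proof.
move=> le_b [m [v [c [Av c_ge0 c1 ->]]]]; rewrite dot_sumr.
rewrite -[b]mul1r -c1 mulr_suml; apply: ler_sum => i _.
by rewrite dotZr ler_wpM2l // le_b.
Qed.

Lemma sub_conv_hull A : A `<=` conv_hull A.
Proof.
move=> x Ax; exists 1%N, (fun _ => x), (fun _ => 1).
by split=> //; rewrite big_ord1 ?scale1r.
Qed.

(** A point of the hull where a functional is maximal is a combination of the
    generators where it is maximal, so what is true of the latter carries over. *)
Lemma conv_hull_max A a b x d p :
  (forall q, A q -> dot a q <= b) ->
  (forall q, A q -> dot a q = b -> dot x q = d) ->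
  conv_hull A p -> dot a p = b -> dot x p = d.
Proof.
move=> le_b max_d [m [v [c [Av c_ge0 c1 ->]]]]; rewrite !dot_sumr => eq_b.
have tight i : c i * (b - dot a (v i)) = 0.
  apply: (psumr_eq0P (P := xpredT) (F := fun i => c i * (b - dot a (v i)))) => // [j _|].
    by rewrite mulr_ge0 // subr_ge0 le_b.
  under eq_bigr do rewrite mulrBr.
  rewrite sumrB -(mulr_suml _ _ _ b) c1 mul1r -[X in X - _]eq_b -sumrB big1 // => j _.
  by rewrite dotZr subrr.
rewrite -[d]mul1r -c1 mulr_suml; apply: eq_bigr => i _; rewrite dotZr.
have /eqP := tight i; rewrite mulf_eq0 subr_eq0 => /orP[/eqP->|/eqP e].
  by rewrite !mul0r.
by rewrite (max_d _ (Av i)).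
Qed.

Lemma lin_span_Cone (s : seq V) : lin_span (Cone [set` s]) = [set` <<s>>%VS].
Proof.
apply/seteqP; split.
  apply: smallest_sub; first by exists <<s>>%VS.
  apply: Cone_min; first by split=> [|x y|t x _] /=; [exact: rpred0|exact: rpredD|exact: rpredZ].
  by move=> x /=; exact: memv_span.
move=> x /= xs W [[U ->] sU]; move: x xs; apply/subvP/span_subvP => x xs.
by apply: sU; exact: sub_Cone.
Qed.

Lemma lin_span_dot0 W b x :
  (forall y, W y -> dot b y = 0) -> lin_span W x -> dot b x = 0.
Proof.
move=> W0; pose f : 'Hom(V, 'M[R]_1) := linfun (mulmxr b^T).
have fE y : f y 0 0 = dot b y by rewrite lfunE /= dotC dotE.
have : lin_span W `<=` [set` lker f].
  apply: smallest_sub; first by exists (lker f).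
  move=> y Wy /=; rewrite memv_ker; apply/eqP/matrixP => i j.
  by rewrite !ord1 fE W0 // mxE.
by move=> /[apply] /=; rewrite memv_ker -fE => /eqP->; rewrite mxE.
Qed.

Lemma lin_spanT_dot W b :
  lin_span W = setT -> (forall x, W x -> dot b x = 0) -> b = 0.
Proof.
move=> spanT W0; apply/rowP => j.
have /(lin_span_dot0 W0) : lin_span W (delta_mx 0 j) by rewrite spanT.
rewrite mxE /dot (bigD1 j) //= !mxE !eqxx mulr1 big1 ?addr0 // => k kj.
by rewrite mxE eqxx (negbTE kj) mulr0.
Qed.

End ConvexCones.

Section SimplicialCones.
Variables (R : realType) (n : nat).
Local Notation V := 'rV[R]_n.
Implicit Types (G : 'M[R]_n) (I K : {set 'I_n}) (x a : V).

Definition crd G x i : R := (x *m invmx G) 0 i.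

Definition face_cone G I : set V :=
  [set x | forall i, 0 <= crd G x i /\ (i \in I -> crd G x i = 0)].

Lemma crdK G x : G \in unitmx -> x = \sum_i crd G x i *: row i G.
Proof. by move=> Gu; rewrite -mulmx_sum_row mulmxKV. Qed.

Lemma crd_comb G (c : 'rV[R]_n) i :
  G \in unitmx -> crd G (\sum_k c 0 k *: row k G) i = c 0 i.
Proof. by move=> Gu; rewrite /crd -mulmx_sum_row mulmxK. Qed.

Lemma crd_row G k i : G \in unitmx -> crd G (row k G) i = (k == i)%:R.
Proof. by move=> Gu; rewrite /crd -row_mul mulmxV // !mxE. Qed.

Lemma crdD G x y i : crd G (x + y) i = crd G x i + crd G y i.
Proof. by rewrite /crd mulmxDl mxE. Qed.

Lemma crdZ G t x i : crd G (t *: x) i = t * crd G x i.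
Proof. by rewrite /crd -scalemxAl mxE. Qed.

Lemma crd0 G i : crd G 0 i = 0.
Proof. by rewrite /crd mul0mx mxE. Qed.

Lemma crd_sum G (J : Type) (r : seq J) (P : pred J) (F : J -> V) i :
  crd G (\sum_(j <- r | P j) F j) i = \sum_(j <- r | P j) crd G (F j) i.
Proof. exact: (big_morph (crd G ^~ i) (fun x y => crdD G x y i) (crd0 G i)). Qed.

Lemma dot_crd G a x : G \in unitmx -> dot a x = \sum_i crd G x i * dot a (row i G).
Proof.
by move=> Gu; rewrite {1}(crdK x Gu) dot_sumr; apply: eq_bigr => i _; rewrite dotZr.
Qed.

Lemma face_cone_convex G I : convex_cone (face_cone G I).
Proof.
split=> [i|x y Wx Wy i|t x t_ge0 Wx i]; rewrite ?crd0 ?crdD ?crdZ //.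
  have [x0 xI] := Wx i; have [y0 yI] := Wy i; split; first exact: addr_ge0.
  by move=> iI; rewrite xI // yI // addr0.
have [x0 xI] := Wx i; split=> [|iI]; first exact: mulr_ge0.
by rewrite xI // mulr0.
Qed.

Lemma face_cone_row G I i : G \in unitmx -> i \notin I -> face_cone G I (row i G).
Proof.
move=> Gu iI k; rewrite crd_row //; split=> // kI.
by case: eqP iI => // ->; rewrite kI.
Qed.

Lemma face_cone_Cone G I : G \in unitmx ->
  face_cone G I = Cone [set` [seq row i G | i <- enum (~: I)]].
Proof.
move=> Gu; apply/seteqP; split; last first.
  apply: Cone_min; first exact: face_cone_convex.
  move=> _ /= /mapP[i + ->]; rewrite mem_enum inE => iI.
  exact: face_cone_row.
move=> x xI; rewrite (crdK x Gu); have Cc := convex_cone_Cone.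
apply: (convex_cone_sum _ (Cc _ _ _)) => i _.
have [C0 _ CZ] := Cc R n [set` [seq row i G | i <- enum (~: I)]].
case: (boolP (i \in I)) => iI; first by rewrite (xI i).2 // scale0r.
apply: CZ; first exact: (xI i).1.
by apply: sub_Cone => /=; apply: map_f; rewrite mem_enum inE.
Qed.

(** The faces of a simplicial cone are cut out by vanishing coordinates: a
    supporting functional vanishes exactly on the generators where it is 0. *)
Lemma face_cone_face G I F : G \in unitmx -> cone_face F (face_cone G I) ->
  exists K, F = face_cone G K.
Proof.
move=> Gu [a [a_ge0 ->]].
exists (I :|: [set i | dot a (row i G) != 0]).
have a_row i : i \notin I -> 0 <= dot a (row i G).
  by move=> iI; apply/a_ge0/face_cone_row.
apply/seteqP; split=> x.
  move=> [xI /= ax] i; split; first exact: (xI i).1.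
  rewrite !inE => /orP[/(xI i).2 //|ai].
  have term_ge0 j : true -> 0 <= crd G x j * dot a (row j G).
    move=> _; have [x0 x1] := xI j.
    case: (boolP (j \in I)) => jI; first by rewrite x1 // mul0r.
    by rewrite mulr_ge0 // a_row.
  rewrite (dot_crd _ _ Gu) in ax.
  have /eqP : crd G x i * dot a (row i G) = 0 by exact: (psumr_eq0P term_ge0 ax).
  by rewrite mulf_eq0 (negbTE ai) orbF => /eqP.
move=> xK; split=> [i|/=].
  by have [x0 x1] := xK i; split=> // iI; apply: x1; rewrite inE iI.
rewrite (dot_crd _ _ Gu) big1 // => i _.
have [->|ai] := eqVneq (dot a (row i G)) 0; first by rewrite mulr0.
by rewrite (xK i).2 ?mul0r // !inE ai orbT.
Qed.

Lemma sub_face_cone G I K : G \in unitmx -> I \subset K ->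
  cone_face (face_cone G K) (face_cone G I).
Proof.
move=> Gu IK; exists (invmx G *m \col_i (i \in K)%:R)^T.
have dE x : dot (invmx G *m \col_i (i \in K)%:R)^T x = \sum_(i in K) crd G x i.
  rewrite dotC dotE trmxK mulmxA mxE [RHS]big_mkcond; apply: eq_bigr => i _.
  by rewrite [X in _ * X]mxE; case: (i \in K); rewrite ?mulr1 ?mulr0.
split=> [x xI|]; first by rewrite dE; apply: sumr_ge0 => i _; exact: (xI i).1.
apply/seteqP; split=> x.
  move=> xK; split=> [i|/=].
    by have [x0 x1] := xK i; split=> // iI; apply: x1; move/fintype.subsetP: IK; exact.
  by rewrite dE big1 // => i iK; exact: (xK i).2.
move=> [xI /=]; rewrite dE => s0 i; split; first exact: (xI i).1.
by move: i; apply: psumr_eq0P => // i _; exact: (xI i).1.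
Qed.

End SimplicialCones.

(** * Charts, their fan and their polytope *)

Section Large.

Lemma all_large (T : eqType) (s : seq T) (Q : T -> nat -> Prop) :
  (forall t, t \in s -> exists N, forall k, (N <= k)%N -> Q t k) ->
  exists N, forall k, (N <= k)%N -> forall t, t \in s -> Q t k.
Proof.
elim: s => [|t s IHs] largeQ; first by exists 0%N.
have [|N1 Q1] := IHs; first by move=> u us; apply: largeQ; rewrite inE us orbT.
have [|N2 Q2] := largeQ t; first by rewrite inE eqxx.
exists (maxn N1 N2) => k; rewrite geq_max => /andP[k1 k2] u.
by rewrite inE => /orP[/eqP->|]; [exact: Q2|exact: Q1].
Qed.

Lemma affine_lt0 (R : realType) (c d : R) :
  c < 0 -> exists N, forall k, (N <= k)%N -> k%:R * c + d < 0.
Proof.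
move=> c_lt0; exists (Num.bound `|d / c|) => k le_k.
rewrite -ltrBrDr sub0r -ltr_ndivrMr // mulNr.
apply: (le_lt_trans (ler_norm _)); rewrite normrN.
by apply: lt_le_trans (archi_boundP (normr_ge0 _)) _; rewrite ler_nat.
Qed.

End Large.

Section Charts.
Variable n : nat.
Local Notation Z := 'rV[int]_n.

(** A chart is a unimodular cone, given by the matrix whose rows generate it,
    together with a linear functional: one linear piece of a support function. *)
Definition chart : Type := ('M[int]_n * 'cV[int]_n)%type.
Implicit Types (P Q : chart) (T : seq chart) (M : 'M[int]_n) (I : {set 'I_n}).

Definition ev (v : Z) (m : 'cV[int]_n) : int := (v *m m) 0 0.
Definition is_row (v : Z) M := [exists j, row j M == v].

Definition unimodular T := forall P, P \in T -> P.1 \in unitmx.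

(** Strict convexity of the support function made of the functionals. Testing it
    on generators is enough because every cone is spanned by its own. *)
Definition coherent T := forall P Q, P \in T -> Q \in T -> forall i,
  ev (row i P.1) Q.2 <= ev (row i P.1) P.2 /\
  (ev (row i P.1) Q.2 = ev (row i P.1) P.2 -> is_row (row i P.1) Q.1).

Lemma is_rowP v M : reflect (exists j, v = row j M) (is_row v M).
Proof. by apply: (iffP existsP) => -[j]; [move/eqP<-|move->]; exists j. Qed.

Lemma row_inj M : M \in unitmx -> injective (fun i => row i M).
Proof.
move=> Mu i j /(congr1 (mulmx^~ (invmx M))); rewrite -!row_mul mulmxV //.
move=> /rowP/(_ i); rewrite !mxE eqxx; case: eqP => // ->; by [].
Qed.

Variable R : realType.
Local Notation V := 'rV[R]_n.

Definition gmx P : 'M[R]_n := map_mx intr P.1.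
(** The functional as a point of the dual space: the vertex of the polytope at
    which the elements of the cone are maximal. *)
Definition vtx P : V := of_int R P.2^T.
Definition cone P : set V := face_cone (gmx P) finset.set0.

Definition covers T := forall x : V, exists2 P, P \in T & cone P x.

Definition fan_of T : set (set V) :=
  [set C | exists P I, P \in T /\ C = face_cone (gmx P) I].

Lemma coneP P x : cone P x <-> forall i, 0 <= crd (gmx P) x i.
Proof. by split=> Px i; [case: (Px i)|split=> //; rewrite inE]. Qed.

Lemma face_sub_cone P I : face_cone (gmx P) I `<=` cone P.
Proof. by move=> x Px; apply/coneP => i; case: (Px i). Qed.

Lemma of_int_row i P : of_int R (row i P.1) = row i (gmx P).
Proof. exact: map_row. Qed.

Lemma gmx_inv P : P.1 \in unitmx ->
  gmx P \in unitmx /\ invmx (gmx P) = map_mx intr (invmx P.1).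
Proof.
move=> Pu; have inv1 : gmx P *m map_mx intr (invmx P.1) = 1%:M.
  by rewrite -map_mxM mulmxV // map_mx1.
have [Gu _] := mulmx1_unit inv1; split=> //.
by rewrite -[RHS](mulKmx Gu) inv1 mulmx1.
Qed.

Lemma crd_of_int P u i : P.1 \in unitmx ->
  crd (gmx P) (of_int R u) i = ((u *m invmx P.1) 0 i)%:~R.
Proof.
by case/gmx_inv => _ E; rewrite /crd E /of_int -map_mxM mxE.
Qed.

Lemma dot_vtx u P : dot (of_int R u) (vtx P) = (ev u P.2)%:~R.
Proof.
by rewrite dotE /vtx /of_int map_trmx trmxK -map_mxM mxE.
Qed.

Lemma of_int_inj : injective (@of_int R n).
Proof. by move=> u v /rowP e; apply/rowP => j; have := e j; rewrite !mxE => /intr_inj. Qed.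

Section Coherent.
Variable T : seq chart.
Hypotheses (Tu : unimodular T) (Tc : coherent T).

Lemma gmx_unit P : P \in T -> gmx P \in unitmx.
Proof. by move=> /Tu /gmx_inv[]. Qed.

Lemma dot_vtx_crd P Q x : P \in T ->
  dot x (vtx Q) = \sum_i crd (gmx P) x i * (ev (row i P.1) Q.2)%:~R.
Proof.
move=> PT; rewrite dotC (dot_crd _ _ (gmx_unit PT)); apply: eq_bigr => i _.
by rewrite -dot_vtx dotC of_int_row.
Qed.

Lemma dot_vtx_le P Q x : P \in T -> Q \in T -> cone P x ->
  dot x (vtx Q) <= dot x (vtx P).
Proof.
move=> PT QT /coneP Px; rewrite !(dot_vtx_crd _ _ PT); apply: ler_sum => i _.
by rewrite ler_wpM2l // ler_int; case: (Tc PT QT i).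
Qed.

Lemma dot_vtx_row P Q x : P \in T -> Q \in T -> cone P x ->
  dot x (vtx Q) = dot x (vtx P) ->
  forall i, crd (gmx P) x i != 0 -> is_row (row i P.1) Q.1.
Proof.
move=> PT QT /coneP Px /esym/eqP; rewrite !(dot_vtx_crd _ _ PT) -subr_eq0 -sumrB => /eqP e i xi.
have term0 : crd (gmx P) x i * (ev (row i P.1) P.2)%:~R
           - crd (gmx P) x i * (ev (row i P.1) Q.2)%:~R = 0 :> R.
  move: i {xi}; have ge0 i : true -> 0 <= crd (gmx P) x i * (ev (row i P.1) P.2)%:~R
           - crd (gmx P) x i * (ev (row i P.1) Q.2)%:~R :> R.
    by move=> _; rewrite subr_ge0 ler_wpM2l // ler_int; case: (Tc PT QT i).
  by move=> i; exact: (psumr_eq0P ge0 e).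
move/eqP: term0; rewrite -mulrBr mulf_eq0 (negbTE xi) /= subr_eq0 eqr_int => /eqP e'.
by case: (Tc PT QT i) => _; apply.
Qed.

(** Charts agree on what they share, which makes coordinates on common faces
    independent of the chart. *)
Lemma crd_transport P Q x : P \in T -> Q \in T ->
  (forall i, crd (gmx P) x i != 0 -> is_row (row i P.1) Q.1) ->
  forall j, crd (gmx Q) x j = \sum_(i | row i P.1 == row j Q.1) crd (gmx P) x i.
Proof.
move=> PT QT rows j; rewrite {1}(crdK x (gmx_unit PT)) crd_sum [RHS]big_mkcond.
apply: eq_bigr => i _; rewrite crdZ.
have [->|xi] := eqVneq (crd (gmx P) x i) 0; first by rewrite mul0r if_same.
have /is_rowP[k ik] := rows i xi.
rewrite -of_int_row ik of_int_row crd_row ?gmx_unit //.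
have [->|kj] := eqVneq k j; first by rewrite eqxx mulr1.
by rewrite mulr0 (inj_eq (row_inj (Tu QT))) (negbTE kj).
Qed.

Lemma cone_transport P Q x : P \in T -> Q \in T -> cone P x ->
  (forall i, crd (gmx P) x i != 0 -> is_row (row i P.1) Q.1) -> cone Q x.
Proof.
move=> PT QT /coneP Px rows; apply/coneP => j.
by rewrite (crd_transport PT QT rows); apply: sumr_ge0.
Qed.

Lemma dot_vtx_cone P Q x : P \in T -> Q \in T -> cone P x ->
  dot x (vtx Q) = dot x (vtx P) <-> cone Q x.
Proof.
move=> PT QT Px; split=> [/(dot_vtx_row PT QT Px)|Qx].
  exact: cone_transport.
by apply/eqP; rewrite eq_le !dot_vtx_le.
Qed.

Lemma cone_rows P Q x : P \in T -> Q \in T -> cone P x -> cone Q x ->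
  forall i, crd (gmx P) x i != 0 -> is_row (row i P.1) Q.1.
Proof. by move=> PT QT Px /(dot_vtx_cone PT QT Px); exact: dot_vtx_row. Qed.

Lemma crd_common P Q x i j : P \in T -> Q \in T -> cone P x -> cone Q x ->
  row i P.1 = row j Q.1 -> crd (gmx P) x i = crd (gmx Q) x j.
Proof.
move=> PT QT Px Qx ij; rewrite (crd_transport PT QT (cone_rows PT QT Px Qx)).
rewrite (big_pred1 i) // => k /=; rewrite -ij.
by rewrite (inj_eq (row_inj (Tu PT))).
Qed.

Lemma face_cone_cap P Q I J : P \in T -> Q \in T -> exists2 K : {set 'I_n},
  I \subset K & face_cone (gmx P) I `&` face_cone (gmx Q) J = face_cone (gmx P) K.
Proof.
move=> PT QT.
exists (I :|: [set i | ~~ is_row (row i P.1) Q.1]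
          :|: [set i | [exists j in J, row i P.1 == row j Q.1]])%SET.
  by rewrite -finset.setUA finset.subsetUl.
apply/seteqP; split=> x.
  move=> [xI xJ] i; have [x_ge0 xi] := xI i; split=> //.
  have Px := face_sub_cone xI; have Qx := face_sub_cone xJ.
  rewrite !inE => /orP[/orP[//|]|/existsP[j /andP[jJ /eqP ij]]].
    by apply: contraNeq; exact: (cone_rows PT QT).
  by rewrite (crd_common PT QT Px Qx ij); apply: (xJ j).2.
move=> xK; have Px := face_sub_cone xK.
have rows i : crd (gmx P) x i != 0 -> is_row (row i P.1) Q.1.
  by apply: contraR => ni; apply/eqP; apply: (xK i).2; rewrite !inE ni orbT.
split=> [i|j].
  by split=> [|iI]; [exact: (xK i).1|apply: (xK i).2; rewrite !inE iI].
split; first by case: (cone_transport PT QT Px rows j).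
move=> jJ; rewrite (crd_transport PT QT rows) big1 // => i ij.
by apply: (xK i).2; rewrite !inE; apply/orP; right; apply/existsP; exists j; rewrite jJ.
Qed.

Lemma is_fan_fan_of : is_fan (fan_of T).
Proof.
split.
- pose f (PI : chart * {set 'I_n}) := face_cone (gmx PI.1) PI.2.
  pose s := [seq (P, J) | P <- T, J <- enum {set 'I_n}].
  apply: sub_finite_set (finite_image f (finite_seq s)) => C [P [I [PT ->]]].
  exists (P, I) => //=; apply/allpairsP; exists (P, I).
  by split=> //=; rewrite mem_enum.
- move=> C [P [I [PT ->]]]; rewrite (face_cone_Cone _ (gmx_unit PT)).
  by eexists.
- move=> C F [P [I [PT ->]]] /(face_cone_face (gmx_unit PT))[K ->].
  by exists P, K.
- move=> C D [P [I [PT ->]]] [Q [J [QT ->]]]; split.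
    have [K IK ->] := face_cone_cap I J PT QT.
    exact: sub_face_cone (gmx_unit PT) IK.
  rewrite setIC; have [K IK ->] := face_cone_cap J I QT PT.
  exact: sub_face_cone (gmx_unit QT) IK.
Qed.

Lemma complete_fan_of : covers T -> complete_fan (fan_of T).
Proof.
move=> Tcov; apply/seteqP; split=> // x _; have [P PT Px] := Tcov x.
by exists (cone P) => //; exists P, finset.set0.
Qed.

(** Primitivity in the form common to its two sources: coprime entries, and an
    integer functional with value 1. *)
Definition indivisible (u : Z) := forall v (k : nat), u = v *+ k -> k = 1%N.

Lemma primitive_indivisible u : primitive u -> indivisible u.
Proof.
move=> pu v k uk; apply/eqP; rewrite -dvdn1 -pu.
apply: (big_ind (fun d => k %| d)%N) => [|d e kd ke|j _]; rewrite ?dvdn0 //.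
  by rewrite dvdn_gcd kd.
by rewrite uk mulmxnE -mulr_natr natz abszM dvdn_mull.
Qed.

Lemma ev_indivisible u m : ev u m = 1 -> indivisible u.
Proof.
move=> um v k uk; apply/eqP; rewrite -dvdn1; have : (k%:Z %| ev u m)%Z.
  by rewrite /ev uk -scaler_nat -scalemxAl mxE natz; exact/dvdz_mulr/dvdzz.
by rewrite um.
Qed.

(** Integrality and indivisibility turn equality of rays into equality of
    generators. *)
Lemma ray_row P u K : P \in T -> indivisible u ->
  Cone [set of_int R u] = face_cone (gmx P) K -> is_row u P.1.
Proof.
move=> PT u_ind uK; have Pu := Tu PT; have Gu := gmx_unit PT.
have uu : face_cone (gmx P) K (of_int R u) by rewrite -uK; exact: sub_Cone.
have u_crd : u = \sum_i (u *m invmx P.1) 0 i *: row i P.1.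
  by rewrite -mulmx_sum_row mulmxKV.
have [K1|[j jK]] : (forall j, j \in K) \/ exists j, j \notin K.
- case: (boolP [forall j, j \in K]) => [/forallP|]; first by left.
  by rewrite negb_forall => /existsP; right.
- have u0 : u = 0.
    rewrite u_crd big1 // => i _; suff -> : (u *m invmx P.1) 0 i = 0 by rewrite scale0r.
    by apply: (@intr_inj R); rewrite -crd_of_int //; apply: (uu i).2.
  by have := u_ind 0 2%N; rewrite mul0rn u0 => /(_ erefl).
have : face_cone (gmx P) K (row j (gmx P)) by exact: face_cone_row.
rewrite -uK => /Cone1P[t t_ge0 tj].
have crd_t i : (j == i)%:R = t * ((u *m invmx P.1) 0 i)%:~R.
  by rewrite -crd_of_int // -crdZ -tj crd_row.
have uj : u = (u *m invmx P.1) 0 j *: row j P.1.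
  rewrite {1}u_crd (bigD1 j) //= big1 ?addr0 // => i ij.
  have := crd_t i; rewrite eq_sym (negbTE ij) => /esym/eqP; rewrite mulf_eq0 intr_eq0.
  case/orP=> [/eqP t0|/eqP->]; last by rewrite scale0r.
  by have := crd_t j; rewrite t0 mul0r eqxx => /eqP; rewrite oner_eq0.
have : 0 <= (u *m invmx P.1) 0 j.
  by rewrite -(ler_int R) -crd_of_int //; exact: (uu j).1.
move: uj; case: (_ 0 j) => // k uj _.
apply/is_rowP; exists j; have k1 := u_ind (row j P.1) k.
by rewrite uj -[Posz k]natz k1 ?scale1r // {1}uj -[Posz k]natz scaler_nat.
Qed.

Lemma Z_basis_unit M : M \in unitmx -> Z_basis M.
Proof.
move=> Mu z; exists (z *m invmx M); split; first by rewrite -mulmx_sum_row mulmxKV.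
by move=> c ->; rewrite -mulmx_sum_row mulmxK.
Qed.

Lemma lin_span_cone P : P \in T -> lin_span (cone P : set V) = setT.
Proof.
move=> PT; have Gu := gmx_unit PT.
rewrite /cone (face_cone_Cone _ Gu) lin_span_Cone; apply/seteqP; split=> // x _ /=.
rewrite (crdK x Gu); apply: rpred_sum => i _; apply/rpredZ/memv_span.
by apply: map_f; rewrite mem_enum !inE.
Qed.

Lemma unimodular_fan_of : unimodular_fan (fan_of T).
Proof.
split.
- move=> C [P [I [PT ->]]]; rewrite (face_cone_Cone _ (gmx_unit PT)) lin_span_Cone.
  exists [seq map_mx intr (row i P.1) | i <- enum (~: I)]; rewrite -map_comp.
  suff -> : [seq row i (gmx P) | i <- enum (~: I)%SET] =
      [seq (@of_rat R n \o (fun i => map_mx intr (row i P.1))) i | i <- enum (~: I)%SET] by [].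
  by apply: eq_map => i /=; apply/rowP => j; rewrite !mxE ratr_int.
- move=> C [P [I [PT ->]]]; rewrite (face_cone_Cone _ (gmx_unit PT)); eexists; split=> //.
  have Gu := gmx_unit PT; set s := map _ _.
  have us : uniq s.
    rewrite map_inj_uniq ?enum_uniq // => i j; rewrite -!of_int_row.
    by move/of_int_inj/(row_inj (Tu PT)).
  apply/freeP => k k0 i; set e := enum (~: I)%SET in s us k k0 i *.
  have si : (i < size e)%N by rewrite /e -cardE.
  have i0 : 'I_n := enum_val i.
  have := congr1 (fun x => crd (gmx P) x (nth i0 e i)) k0.
  rewrite crd0 crd_sum (bigD1 i) //= big1 => [|j ji].
    by rewrite addr0 crdZ (nth_map i0) // crd_row // eqxx mulr1.
  rewrite crdZ (nth_map i0); last by rewrite /e -cardE.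
  rewrite crd_row // nth_uniq ?enum_uniq //; last by rewrite /e -cardE.
  by rewrite (inj_eq val_inj) (negbTE ji) mulr0.
- move=> C [P [I [PT ->]]]; exists (cone P); split.
  + by exists P, finset.set0.
  + exact: face_sub_cone.
  exact: lin_span_cone.
- move=> C [P [I [PT ->]]]; exists P.1; split; first exact: Z_basis_unit (Tu PT).
  move=> u [pu] /(face_cone_face (gmx_unit PT))[K uK].
  exact/is_rowP/(ray_row PT (primitive_indivisible pu) uK).
Qed.

Section Polytope.
Hypothesis Tcov : covers T.
Local Notation hull := (conv_hull [set` map vtx T]).

(** Leaving the relative interior point a of a face in the direction opposite to a
    generator outside that face leads into a cone which contains the face and not
    that generator. *)
Lemma other_cone P a i : P \in T -> cone P a -> crd (gmx P) a i = 0 ->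
  exists Q, [/\ Q \in T, cone Q a & ~~ is_row (row i P.1) Q.1].
Proof.
move=> PT Pa ai.
(* Finitely many closed cones: those containing points N a - row i for large N
   contain their limit direction a. *)
have [N largeN] : exists N, forall k, (N <= k)%N -> forall Q, Q \in T ->
    cone Q (k%:R *: a - row i (gmx P)) -> cone Q a.
  apply: all_large => Q QT; have [Qa|nQa] := pselect (cone Q a); first by exists 0%N.
  have /existsNP[j /negP] : ~ forall j, 0 <= crd (gmx Q) a j by move/coneP.
  rewrite -ltNge => Qj.
  have [N ltN] := affine_lt0 (crd (gmx Q) (- row i (gmx P)) j) Qj.
  exists N => k /ltN; rewrite -crdZ -crdD => lt0 /coneP/(_ j).
  by rewrite leNgt lt0.
have [Q QT Qk] := Tcov (N%:R *: a - row i (gmx P)).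
have Qa := largeN N (leqnn _) Q QT Qk.
exists Q; split=> //; apply/is_rowP => -[j ij].
have /coneP/(_ j) := Qk.
rewrite crdD crdZ -(crd_common PT QT Pa Qa ij) ai mulr0 add0r -scaleN1r crdZ.
by rewrite -of_int_row ij of_int_row crd_row ?gmx_unit // eqxx mulr1 ler0N1.
Qed.

Lemma normal_cone_face P a : P \in T -> cone P a ->
  normal_cone hull (hull `&` [set p | dot a p = dot a (vtx P)])
    = face_cone (gmx P) [set i | crd (gmx P) a i == 0].
Proof.
move=> PT Pa.
have vtx_hull Q : Q \in T -> hull (vtx Q) by move=> QT; apply/sub_conv_hull/map_f.
have hull_le y q : cone P y -> hull q -> dot y q <= dot y (vtx P).
  by move=> Py; apply: conv_hull_le => _ /mapP[Q QT ->]; exact: dot_vtx_le.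
apply/seteqP; split=> x.
  move=> xF; have [Q QT Qx] := Tcov x.
  have Px : cone P x.
    apply/(dot_vtx_cone QT PT Qx)/eqP; rewrite eq_le dot_vtx_le //=.
    by rewrite -subr_ge0 -dotBr; apply: xF; [split=> //; exact: vtx_hull|exact: vtx_hull].
  move=> i; split; first by move/coneP: Px.
  rewrite inE => /eqP ai; have [S [ST Sa nS]] := other_cone PT Pa ai.
  apply: contraNeq nS; apply: (cone_rows PT ST Px).
  apply/(dot_vtx_cone PT ST Px)/eqP; rewrite eq_le dot_vtx_le //=.
  rewrite -subr_ge0 -dotBr; apply: xF; last exact: vtx_hull.
  by split; [exact: vtx_hull|exact/(dot_vtx_cone PT ST Pa)].
move=> xI p q [hp /= ap] hq; have Px := face_sub_cone xI.
rewrite dotBr subr_ge0; suff -> : dot x p = dot x (vtx P) by exact: hull_le.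
apply: (conv_hull_max (a := a) (b := dot a (vtx P))) hp ap.
  by move=> r rT; apply: hull_le => //; exact: sub_conv_hull.
move=> _ /mapP[Q QT ->] /(dot_vtx_row PT QT Pa) rows.
apply/(dot_vtx_cone PT QT Px); apply: (cone_transport PT QT Px) => i xi.
apply: rows; apply: contraNneq xi => ai; apply/eqP; apply: (xI i).2.
by rewrite inE ai.
Qed.

Lemma polytopal_fan_of : polytopal (fan_of T).
Proof.
exists (map vtx T); apply/seteqP; split=> C.
  move=> [P [I [PT ->]]]; have Gu := gmx_unit PT.
  (* A point in the relative interior of the face. *)
  pose a := \sum_i (\row_i (i \notin I)%:R : V) 0 i *: row i (gmx P).
  have ai i : crd (gmx P) a i = (i \notin I)%:R by rewrite crd_comb // mxE.
  have Pa : cone P a by apply/coneP => i; rewrite ai ler0n.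
  exists (hull `&` [set p | dot a p = dot a (vtx P)]); split.
  - exists a, (dot a (vtx P)); split=> //; move=> x; apply: conv_hull_le => _ /mapP[Q QT ->].
    exact: dot_vtx_le.
  - by exists (vtx P); split=> //; apply/sub_conv_hull/map_f.
  rewrite normal_cone_face //; congr (face_cone _ _); apply/setP => i.
  by rewrite inE ai; case: (i \in I); rewrite /= ?eqxx ?oner_eq0.
move=> [_ [[a [b [le_b ->]]] [p [hp /= ap]] ->]].
have [P PT Pa] := Tcov a.
have -> : b = dot a (vtx P).
  apply/eqP; rewrite eq_le; apply/andP; split; last exact/le_b/sub_conv_hull/map_f.
  by rewrite -ap; apply: (conv_hull_le _ hp) => _ /mapP[Q QT ->]; exact: dot_vtx_le.
by rewrite normal_cone_face //; exists P; eexists.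
Qed.

End Polytope.
End Coherent.
End Charts.

(** * The star of the new ray of a blow-up *)

Section BlowUp.
Variables (R : realType) (n : nat).
Local Notation V := 'rV[R]_n.
Local Notation Z := 'rV[int]_n.

Lemma dot_of_int (u v : Z) : dot (of_int R u) (of_int R v) = (ev u v^T)%:~R.
Proof. by rewrite dotE /of_int map_trmx -map_mxM mxE. Qed.

Lemma of_int_sum (s : seq Z) : of_int R (\sum_(u <- s) u) = \sum_(u <- s) of_int R u.
Proof.
apply: (big_morph (@of_int R n)) => [u v|]; apply/rowP => j; rewrite !mxE //.
exact: intrD.
Qed.

(** The dual family witnesses at once the linear independence of s and the
    indivisibility of sums of distinct members. *)
Lemma basis_dual (s : seq Z) : part_of_Z_basis [set` s] ->
  forall u, u \in s -> exists w : Z, forall v, v \in s -> ev v w^T = (v == u)%:R.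
Proof.
move=> [B [Bb sB]] u us.
have Bu : B \in unitmx.
  have row_ex j : exists c : Z, delta_mx 0 j = c *m B.
    by have [c [-> _]] := Bb (delta_mx 0 j); exists c; rewrite mulmx_sum_row.
  pose D := \matrix_j projT1 (cid (row_ex j)).
  suff /mulmx1_unit[] : D *m B = 1%:M by [].
  apply/row_matrixP => j; rewrite row_mul rowK -(projT2 (cid (row_ex j))).
  by apply/rowP => k; rewrite !mxE eqxx eq_sym.
have [j uj] := sB _ us.
exists (col j (invmx B))^T => v /sB[k ->]; rewrite trmxK /ev uj.
have -> : (row k B *m col j (invmx B)) 0 0 = (B *m invmx B) k j.
  by rewrite !mxE; apply: eq_bigr => l _; rewrite !mxE.
by rewrite mulmxV // mxE (inj_eq (row_inj Bu)); case: eqP.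
Qed.

Lemma crd_dot (H : 'M[R]_n) i x : crd H x i = dot (col i (invmx H))^T x.
Proof. by rewrite dotC dotE trmxK /crd !mxE; apply: eq_bigr => k _; rewrite !mxE. Qed.

Lemma full_simplicial_cone (C : set V) : simplicial_cone C -> lin_span C = setT ->
  exists2 H : 'M[R]_n, H \in unitmx & C = face_cone H finset.set0.
Proof.
move=> [s [fs ->]]; rewrite lin_span_Cone => sT.
have sf : <<s>>%VS = fullv.
  apply/eqP; rewrite eqEsubv subvf; apply/subvP => x _.
  by have : [set` <<s>>%VS] x by rewrite sT.
have sz : size s = n.
  by move: fs; rewrite /free sf dimvf /dim /= mul1n => /eqP.
pose H : 'M[R]_n := \matrix_(i < n) s`_i.
have Hu : H \in unitmx.
  rewrite -row_full_unit -sub1mx; apply/row_subP => j.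
  have : row j 1%:M \in <<in_tuple s>>%VS by rewrite sf memvf.
  move/coord_span => ->; apply: summx_sub => i _; apply: scalemx_sub.
  have i_lt : (i < n)%N by rewrite -[X in (_ < X)%N]sz.
  by rewrite (_ : _`_i = row (Ordinal i_lt) H) ?row_sub // rowK.
exists H => //; rewrite face_cone_Cone //; congr Cone; apply/seteqP; split=> x /=.
  move=> /(nthP 0)[i]; rewrite sz => i_lt <-.
  apply/mapP; exists (Ordinal i_lt); first by rewrite mem_enum !inE.
  by rewrite rowK.
by move=> /mapP[i _ ->]; rewrite rowK mem_nth // sz.
Qed.

Variable T : seq (chart n).
Hypotheses (Tu : unimodular T) (Tc : coherent T).

Lemma ray_in_cone u P : indivisible u -> P \in T ->
  fan_of T (Cone [set of_int R u]) -> cone P (of_int R u) -> is_row u P.1.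
Proof.
move=> u_ind PT [Q [J [QT uJ]]] Pu.
have [K _ capK] := face_cone_cap R Tu Tc finset.set0 J PT QT.
apply: (ray_row (R := R) Tu PT u_ind (K := K)); rewrite -capK -uJ; apply/seteqP; split.
  move=> x xu; split=> //; move: x xu.
  by apply: Cone_min; [exact: face_cone_convex|move=> _ ->].
by move=> x [].
Qed.

(** What a blow-up looks like around its new ray g, read off from the subdivided
    fan. A maximal cone at g is spanned by g and a cone D0 of the old fan. Inside
    the simplicial old cone C' that contains both, D0 must be the facet opposite
    to one generator; since the blown-up cone C is a face of C', that generator is
    the only member of s outside D0. *)
Lemma blowup_rows (Sigma0 : set (set V)) :
  is_fan Sigma0 -> simplicial_fan Sigma0 -> is_blowup (fan_of T) Sigma0 ->
  exists s : seq Z, let g := \sum_(u <- s) u in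
  [/\ uniq s, (2 <= size s)%N, g \notin s,
      forall u, u \in s -> exists P, [/\ P \in T, is_row g P.1 & is_row u P.1]
    & forall P, P \in T -> is_row g P.1 ->
        exists2 b, b \in s & forall u, u \in s -> u != b -> is_row u P.1].
Proof.
move=> [_ _ face0 cap0] simp0 [C [s [C0 [us s_ray Cs s_basis] s2 fanE]]].
exists s => g; set gR := of_int R g.
have gE : gR = \sum_(u <- s) of_int R u by rewrite /gR of_int_sum.
rewrite -gE in fanE.
have [w wE] : exists w : Z -> Z, forall u v, u \in s -> v \in s -> ev v (w u)^T = (v == u)%:R.
  have dual := basis_dual s_basis.
  exists (fun u => if pselect (u \in s) is left us then projT1 (cid (dual u us)) else 0).
  move=> u v us' vs; case: pselect => // uss.
  exact: (projT2 (cid (dual u uss))).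
have wR u v : u \in s -> v \in s -> dot (of_int R (w u)) (of_int R v) = (v == u)%:R.
  by move=> us' vs; rewrite dotC dot_of_int wE //; case: eqP.
have wg u : u \in s -> dot (of_int R (w u)) gR = 1.
  move=> us'; rewrite gE dot_sumr (bigD1_seq u) //= wR // eqxx big_seq_cond big1 ?addr0 //.
  by move=> v /andP[vs /negbTE vu]; rewrite wR // vu.
have g_ind : indivisible g.
  have us0 : s`_0 \in s by rewrite mem_nth //; exact: leq_trans s2.
  apply: (@ev_indivisible _ _ (w s`_0)^T); apply: (@intr_inj R).
  by rewrite -dot_of_int dotC wg.
have s_ind u : u \in s -> indivisible u.
  by move=> us'; apply: (@ev_indivisible _ _ (w u)^T); rewrite wE // eqxx.
have sC u : u \in s -> C (of_int R u).
  by move=> us'; rewrite Cs; apply: sub_Cone => /=; exact: map_f.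
have Cc : convex_cone C by rewrite Cs; exact: convex_cone_Cone.
have gC : C gR.
  by rewrite gE big_seq; apply: (convex_cone_sum _ Cc) => u; exact: sC.
have other u : u \in s -> exists2 v, v \in s & v != u.
  move=> us'; apply: contrapT => no.
  have : (size s <= size [:: u])%N.
    apply: uniq_leq_size => // v vs; rewrite inE; apply: contrapT => /negP vu.
    by apply: no; exists v.
  by rewrite /= leqNgt s2.
have wC u x : u \in s -> C x -> 0 <= dot (of_int R (w u)) x.
  move=> us' Cx.
  have : Cone [set` map (@of_int R n) s] `<=` [set x | 0 <= dot (of_int R (w u)) x].
    apply: Cone_min; last by move=> _ /= /mapP[v vs ->]; rewrite wR.
    split=> [/=|y z /= y0 z0|t y /= t0 y0]; rewrite ?dot0r ?dotDr ?dotZr //.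
      exact: addr_ge0.
    exact: mulr_ge0.
  by rewrite -Cs; apply.
have ray_u u : u \in s -> fan_of T (Cone [set of_int R u]).
  move=> us'; have [_ uC] := (s_ray u).1 us'; rewrite fanE; left.
  split; first exact: face0 uC.
  have [v vs vu] := other u us'.
  move=> /Cone1P[t _ gt]; have := wg v vs.
  by rewrite gt dotZr wR // eq_sym (negbTE vu) mulr0 => /eqP; rewrite eq_sym oner_eq0.
have ray_g : fan_of T (Cone [set gR]).
  rewrite fanE; right; exists [set 0]; split.
  - apply: (face0 C) => //; exists (\sum_(u <- s) of_int R (w u)).
    have dE x : dot (\sum_(u <- s) of_int R (w u)) x = \sum_(u <- s) dot (of_int R (w u)) x.
      by rewrite dotC dot_sumr; under eq_bigr do rewrite dotC.
    split=> [x Cx|].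
      by rewrite dE big_seq; apply: sumr_ge0 => u us'; exact: wC.
    apply/seteqP; split=> x.
      by move=> ->; split; [case: Cc|rewrite /= dot0r].
    move=> [Cx /=]; rewrite dE => x0.
    have w0 u : u \in s -> dot (of_int R (w u)) x = 0.
      move=> us'; apply/eqP; rewrite eq_le wC // andbT -x0.
      rewrite (bigD1_seq u) //= lerDl big_seq_cond.
      by apply: sumr_ge0 => v /andP[vs _]; exact: wC.
    move: Cx; rewrite Cs => -[m [v [c [vs c0 xE]]]].
    rewrite xE big1 // => k _; have /mapP[u us' ku] := vs k.
    have term0 : c k * dot (of_int R (w u)) (v k) = 0.
      have : \sum_k c k * dot (of_int R (w u)) (v k) = dot (of_int R (w u)) x.
        by rewrite xE dot_sumr; apply: eq_bigr => l _; rewrite dotZr.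
      rewrite w0 // => S0; apply: (psumr_eq0P _ S0) => // l _.
      by rewrite mulr_ge0 //; have /mapP[u' us'' ->] := vs l; rewrite wR.
    by move: term0; rewrite ku wR // eqxx mulr1 => ->; rewrite scale0r.
  - move=> /= g0; have us0 : s`_0 \in s by rewrite mem_nth //; exact: leq_trans s2.
    by have := wg _ us0; rewrite g0 dot0r => /eqP; rewrite eq_sym oner_eq0.
  - by exists C; split=> // x [->|->] //; case: Cc.
  - apply/seteqP; split.
      apply: Cone_min; first exact: convex_cone_Cone.
      by move=> x ->; apply: sub_Cone; left.
    apply: Cone_min; first exact: convex_cone_Cone.
    have [? _ _] := convex_cone_Cone [set gR].
    by move=> x [->|->] //; exact: sub_Cone.
split=> //.
- apply/negP => gs; have [v vs vg] := other g gs.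
  by have := wg v vs; rewrite /gR wR // eq_sym (negbTE vg) => /eqP; rewrite eq_sym oner_eq0.
- move=> u us'; have [v vs vu] := other u us'.
  pose C1 := C `&` [set x | dot (of_int R (w v)) x = 0].
  have C1E : cone_face C1 C.
    by exists (of_int R (w v)); split=> // x; exact: wC.
  have : fan_of T (Cone (gR |` C1)).
    rewrite fanE; right; exists C1; split=> //.
    - exact: face0 C1E.
    - by move=> [_ /=]; rewrite wg // => /eqP; rewrite oner_eq0.
    - by exists C; split=> // x [[]|->].
  move=> [P [I [PT PE]]]; exists P; split=> //.
    apply: ray_in_cone => //; apply: (@face_sub_cone _ _ _ I); rewrite -PE.
    by apply: sub_Cone; left.
  apply: ray_in_cone => //; [exact: s_ind|exact: ray_u|].
  apply: (@face_sub_cone _ _ _ I); rewrite -PE; apply: sub_Cone; right.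
  by split; [exact: sC|rewrite /= wR // eq_sym (negbTE vu)].
move=> P PT /is_rowP[i0 gi0].
have Pg : cone P gR.
  rewrite /gR gi0 of_int_row; apply: face_cone_row; rewrite ?inE //.
  exact: gmx_unit PT.
have : fan_of T (cone P : set V) by exists P, finset.set0.
rewrite fanE => -[[_ /(_ Pg)] //|[D0 [D0S D0g [C' [C'S subC'] PE]]]].
have C'g : C' gR by apply: subC'; right.
have subC : C `<=` C'.
  have [[a [a_ge0 aE]] _] := cap0 _ _ C0 C'S.
  have ag : dot a gR = 0 by have [] : (C `&` [set x | dot a x = 0]) gR by rewrite -aE.
  have au u : u \in s -> dot a (of_int R u) = 0.
    move=> us'; apply/eqP; rewrite eq_le a_ge0 ?andbT; last exact: sC.
    rewrite -ag gE dot_sumr (bigD1_seq u) //= lerDl big_seq_cond.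
    by apply: sumr_ge0 => v /andP[vs _]; exact/a_ge0/sC.
  move=> x; rewrite Cs; move: x; apply: Cone_min.
    by have [s' [_ ->]] := simp0 _ C'S; exact: convex_cone_Cone.
  move=> _ /= /mapP[u us' ->].
  suff [] : (C `&` C') (of_int R u) by [].
  by rewrite aE; split=> /=; [exact: sC|exact: au].
have CfC' : cone_face C C'.
  by have [_] := cap0 _ _ C0 C'S; rewrite (_ : C `&` C' = C) //; apply/setIidl.
have D0fC' : cone_face D0 C'.
  have [_] := cap0 _ _ D0S C'S; rewrite (_ : D0 `&` C' = D0) //; apply/setIidl.
  by move=> x Dx; apply: subC'; left.
have C'c : convex_cone C'.
  by have [s' [_ ->]] := simp0 _ C'S; exact: convex_cone_Cone.
have C'T : lin_span C' = setT.
  apply/seteqP; split=> // x _; have : lin_span (cone P : set V) x by rewrite (lin_span_cone R Tu).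
  move=> xP W [WU C'W]; apply: xP; split=> // z Pz; apply: C'W; move: z Pz; rewrite PE.
  apply: Cone_min => // y [->|D0y] //.
  by apply: subC'; left.
(* Coordinates in C': the faces C and D0 become the index sets J and K, and K is
   reduced to one index i. *)
have [H Hu C'H] := full_simplicial_cone (simp0 _ C'S) C'T.
rewrite C'H in CfC' D0fC' C'g.
have [J CJ] := face_cone_face Hu CfC'.
have [K D0K] := face_cone_face Hu D0fC'.
have g_ge0 i : 0 <= crd H gR i by case: (C'g i).
have [i iK gi] : exists2 i, i \in K & crd H gR i != 0.
  apply: contrapT => no; apply: D0g; rewrite D0K => i; split=> // iK.
  by apply: contrapT => /eqP gi; apply: no; exists i.
have Ki j : j \in K -> j = i.
  move=> jK; apply: contrapT => /eqP ji.
  pose b := crd H gR i *: (col j (invmx H))^T - crd H gR j *: (col i (invmx H))^T.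
  have bE x : dot b x = crd H gR i * crd H x j - crd H gR j * crd H x i.
    by rewrite dotC dotBr !dotZr !(dotC x) -!crd_dot.
  have b0 : b = 0.
    apply: (lin_spanT_dot (lin_span_cone R Tu PT)) => x; rewrite PE => xP.
    have D0c : convex_cone D0 by rewrite D0K; exact: face_cone_convex.
    have [t [y [_ D0y ->]]] := Cone_setU1 D0c xP.
    move: D0y; rewrite bE D0K !crdD !crdZ => D0y.
    by rewrite (D0y i).2 // (D0y j).2 // !addr0; ring.
  have := bE (row j H); rewrite b0 dotC dot0r !crd_row // eqxx (negbTE ji) mulr1 mulr0 subr0.
  by move/esym/eqP; rewrite (negbTE gi).
have iJ : i \notin J.
  by apply: contra gi => iJ; apply/eqP; move: gC; rewrite CJ => /(_ i)[_]; apply.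
(* The generator of C' opposite to D0 belongs to C, hence is spanned by one
   member b of s. *)
have : C (row i H) by rewrite CJ; exact: face_cone_row.
rewrite {1}Cs => -[m [v [c [vs c_ge0 iE]]]].
have v_ge0 k j : 0 <= crd H (v k) j.
  have /mapP[u us' ->] := vs k.
  by have := sC u us'; rewrite CJ => /(_ j)[].
have crd_i j : (i == j)%:R = \sum_k c k * crd H (v k) j.
  by rewrite -(crd_row i j Hu) iE crd_sum; apply: eq_bigr => k _; rewrite crdZ.
have [k ki] : exists k, c k * crd H (v k) i != 0.
  apply: contrapT => no; have := crd_i i; rewrite eqxx big1 => [/eqP|k _].
    by rewrite oner_eq0.
  by apply: contrapT => /eqP ki; apply: no; exists k.
have kj j : j != i -> crd H (v k) j = 0.
  move=> ji; have := crd_i j; rewrite eq_sym (negbTE ji) => /esym S0.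
  have /eqP : c k * crd H (v k) j = 0.
    by apply: (psumr_eq0P _ S0) => // l _; exact: mulr_ge0.
  by rewrite mulf_eq0 => /orP[/eqP ck|/eqP//]; rewrite ck mul0r eqxx in ki.
have lam_gt0 : 0 < crd H (v k) i.
  by rewrite lt_neqAle v_ge0 andbT eq_sym; apply: contraNneq ki => ->; rewrite mulr0.
have /mapP[b bs vb] := vs k.
have row_b : row i H = (crd H (v k) i)^-1 *: of_int R b.
  have vkE : v k = crd H (v k) i *: row i H.
    rewrite {1}(crdK (v k) Hu) (bigD1 i) //= big1 ?addr0 // => j ji.
    by rewrite kj // scale0r.
  by rewrite -vb [X in _ *: X]vkE scalerA mulVf ?scale1r // gt_eqF.
exists b => // u us' ub; apply: ray_in_cone => //; [exact: s_ind|exact: ray_u|].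
suff ui : crd H (of_int R u) i = 0.
  rewrite PE; apply: sub_Cone; right; rewrite D0K => j; split.
    by have := sC u us'; rewrite CJ => /(_ j)[].
  by move=> /Ki ->.
have u_ge0 j : 0 <= crd H (of_int R u) j by have := sC u us'; rewrite CJ => /(_ j)[].
(* Removing its component along b leaves u in C, while the functional dual to b
   is nonnegative on C and vanishes on u. *)
have Cy : C (of_int R u - crd H (of_int R u) i *: row i H).
  rewrite CJ => j; rewrite crdD -scaleN1r !crdZ crd_row //.
  have [<-|ij] := eqVneq i j; first by rewrite mulr1 mulN1r subrr.
  rewrite !mulr0 addr0; split=> // jJ.
  by have := sC u us'; rewrite CJ => /(_ j)[_]; apply.
have := wC b _ bs Cy; rewrite dotBr wR // (negbTE ub) sub0r dotZr row_b dotZr wR // eqxx mulr1.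
rewrite oppr_ge0 pmulr_lle0 ?invr_gt0 // => ui.
by apply/eqP; rewrite eq_le ui u_ge0.
Qed.

End BlowUp.

(** * Subdivisions with a perturbed support function *)

Section Refine.
Variable n : nat.
Local Notation Z := 'rV[int]_n.
Implicit Types (P Q : chart n) (T : seq (chart n)) (M : 'M[int]_n) (S : {set 'I_n}).

Definition ssum S M : Z := \sum_(i in S) row i M.

(** One cone of a subdivision of a chart, in local coordinates: its generators are
    the sums of generators over the given index sets, and the vector is the linear
    functional by which the support function is perturbed on it. *)
Definition piece : Type := ({ffun 'I_n -> {set 'I_n}} * 'cV[int]_n)%type.
Implicit Types (q r : piece).

Definition piece_mx q : 'M[int]_n := \matrix_(j, k) (k \in q.1 j)%:R.

Definition subchart N P q : chart n :=
  (piece_mx q *m P.1, P.2 *+ N + invmx P.1 *m q.2).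

Arguments subchart : simpl never.

Definition refine N T (pat : chart n -> seq piece) : seq (chart n) :=
  [seq subchart N P q | P <- T, q <- pat P].

Lemma refineP N T pat P' : reflect
  (exists P q, [/\ P \in T, q \in pat P & P' = subchart N P q])
  (P' \in refine N T pat).
Proof.
apply: (iffP allpairsPdep) => -[P [q [PT qP ->]]]; by exists P, q.
Qed.

Lemma row_subchart N P q j : row j (subchart N P q).1 = ssum (q.1 j) P.1.
Proof.
rewrite row_mul mulmx_sum_row /ssum [RHS]big_mkcond; apply: eq_bigr => i _.
by rewrite !mxE; case: (i \in _); rewrite ?scale1r ?scale0r.
Qed.

Lemma ev_sum (I : Type) (s : seq I) (p : pred I) (F : I -> Z) m :
  ev (\sum_(i <- s | p i) F i) m = \sum_(i <- s | p i) ev (F i) m.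
Proof. by rewrite /ev mulmx_suml summxE. Qed.

Lemma ev_subchart N P q v : ev v (subchart N P q).2 =
  ev v P.2 *+ N + ev v (invmx P.1 *m q.2).
Proof. by rewrite /ev mulmxDr -[P.2 *+ N]scaler_nat -scalemxAr mxE [X in X + _]mxE mulr_natl. Qed.

Lemma ev_ssum_local P (a : 'cV[int]_n) S : P.1 \in unitmx ->
  ev (ssum S P.1) (invmx P.1 *m a) = \sum_(i in S) a i 0.
Proof.
move=> Pu; rewrite ev_sum; apply: eq_bigr => i _.
by rewrite /ev mulmxA -row_mul mulmxV // row1 -rowE mxE.
Qed.

Lemma ssum_inj M S S' : M \in unitmx -> ssum S M = ssum S' M -> S = S'.
Proof.
move=> Mu eqS; apply/setP => i.
have mem U : ev (ssum U M) (invmx M *m delta_mx i 0) = (i \in U)%:R.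
  rewrite (@ev_ssum_local (M, 0)) //; under eq_bigr do rewrite mxE andbT.
  have [iU|niU] := boolP (i \in U).
    by rewrite (bigD1 i) //= eqxx big1 ?addr0 // => j /andP[_ /negbTE->].
  by rewrite big1 // => j jU; case: eqP jU niU => // -> ->.
by have := mem S; rewrite eqS mem; case: (i \in S); case: (i \in S').
Qed.

Lemma ssum1 M i : ssum [set i] M = row i M.
Proof. by rewrite /ssum big_set1. Qed.

Section Transport.
Variable T : seq (chart n).
Hypotheses (Tu : unimodular T) (Tc : coherent T).

Lemma ev_ssum_le P Q S : P \in T -> Q \in T ->
  ev (ssum S P.1) Q.2 <= ev (ssum S P.1) P.2.
Proof.
by move=> PT QT; rewrite !ev_sum; apply: ler_sum => i _; case: (Tc PT QT i).
Qed.

Lemma ev_ssum_eq P Q S : P \in T -> Q \in T ->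
  ev (ssum S P.1) Q.2 = ev (ssum S P.1) P.2 ->
  forall i, i \in S -> is_row (row i P.1) Q.1.
Proof.
move=> PT QT; rewrite !ev_sum => /esym/eqP; rewrite -subr_eq0 -sumrB => /eqP S0 i iS.
have [_] := Tc PT QT i; apply; apply/esym/eqP; rewrite -subr_eq0.
apply/eqP; apply: (psumr_eq0P _ S0 iS) => j _.
by rewrite subr_ge0; case: (Tc PT QT j).
Qed.

Lemma ssum_transport P Q S : P \in T ->
  (forall i, i \in S -> is_row (row i P.1) Q.1) ->
  exists S', [/\ ssum S' Q.1 = ssum S P.1, #|S'| = #|S|
    & forall j, j \in S' -> is_row (row j Q.1) P.1].
Proof.
move=> PT rows.
pose f i := if [pick j | row j Q.1 == row i P.1] is Some j then j else i.
have fE i : i \in S -> row (f i) Q.1 = row i P.1.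
  move=> /rows/is_rowP[j ij]; rewrite /f; case: pickP => [k /eqP //|/(_ j)].
  by rewrite ij eqxx.
have f_inj : {in S &, injective f}.
  by move=> i j iS jS ij; apply: (row_inj (Tu PT)); rewrite /= -!fE // ij.
exists (f @: S); split.
- by rewrite /ssum big_imset //=; apply: eq_bigr => i iS; rewrite fE.
- exact: card_in_imset.
by move=> _ /imsetP[i iS ->]; apply/is_rowP; exists i; rewrite fE.
Qed.

(** Subset sums lie in the cone they are built from, so the two support functionals
    of charts sharing such a vector compare in both directions. *)
Lemma ssum_common P Q S S' : P \in T -> Q \in T -> ssum S P.1 = ssum S' Q.1 ->
  forall i, i \in S -> is_row (row i P.1) Q.1.
Proof.
move=> PT QT eqS; apply: ev_ssum_eq => //; apply/eqP; rewrite eq_le ev_ssum_le //=.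
by rewrite eqS ev_ssum_le.
Qed.

(** Instead of scaling the perturbation down, the old support function is scaled
    up by N, which keeps everything integral: where two old functionals differ they
    decide, and on common faces the pieces are compared by the heights ht alone.
    Heights may depend on a new generator only through the vector and the number of
    old generators of which it is the sum, so that they agree on common faces; the
    conditions then concern one cone at a time. *)
Lemma refine_coherent (pat : chart n -> seq piece) (occurs : nat -> Z -> Prop)
    (ht : nat -> Z -> int) :
  (forall P q j, P \in T -> q \in pat P -> occurs #|q.1 j| (ssum (q.1 j) P.1)) ->
  (forall P q j, P \in T -> q \in pat P ->
    \sum_(i in q.1 j) q.2 i 0 = ht #|q.1 j| (ssum (q.1 j) P.1)) ->
  (forall P q S, P \in T -> q \in pat P -> occurs #|S| (ssum S P.1) ->
    \sum_(i in S) q.2 i 0 <= ht #|S| (ssum S P.1) /\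
    (\sum_(i in S) q.2 i 0 = ht #|S| (ssum S P.1) -> exists j, q.1 j = S)) ->
  exists N, coherent (refine N T pat).
Proof.
move=> patV patE patL.
pose pre := [seq (P, q) | P <- T, q <- pat P].
pose quad := [seq (xy, j) | xy <- [seq (x, y) | x <- pre, y <- pre], j <- enum 'I_n].
have preP x : x \in pre -> x.1 \in T /\ x.2 \in pat x.1.
  by move=> /allpairsPdep[P [q [PT qP ->]]].
pose good P q Q r j (N : nat) :=
  ev (row j (subchart N P q).1) (subchart N Q r).2
    <= ev (row j (subchart N P q).1) (subchart N P q).2 /\
  (ev (row j (subchart N P q).1) (subchart N Q r).2
     = ev (row j (subchart N P q).1) (subchart N P q).2 ->
   is_row (row j (subchart N P q).1) (subchart N Q r).1).
have [N NP] : exists N, forall k, (N <= k)%N -> forall t, t \in quad ->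
    good t.1.1.1 t.1.1.2 t.1.2.1 t.1.2.2 t.2 k.
  apply: all_large => _ /allpairsP[[xy j] [/= /allpairsP[[x y] [/= xp yp ->]] _ ->]].
  case: x y xp yp => [P q] [Q r] /preP[/= PT qP] /preP[/= QT rQ].
  rewrite /= /good; set S := q.1 j; set v := ssum S P.1.
  have vP : ev v (invmx P.1 *m q.2) = ht #|S| v by rewrite ev_ssum_local; [exact: patE|exact: Tu].
  have vV : occurs #|S| v by exact: patV.
  have := ev_ssum_le S PT QT; rewrite -/v le_eqVlt => /orP[/eqP vPQ|vPQ].
    exists 0%N => k _; rewrite row_subchart !ev_subchart -/S -/v vPQ lerD2l vP.
    have [S' [vS' cS' _]] := ssum_transport PT (ev_ssum_eq PT QT vPQ).
    rewrite -/v in vS'; have vQ := @ev_ssum_local Q r.2 S' (Tu QT).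
    rewrite vS' in vQ; have := patL Q r S' QT rQ; rewrite vS' cS' -vQ => /(_ vV)[leQ eqQ].
    split=> // /addrI /eqQ[i iS']; apply/is_rowP; exists i.
    by rewrite row_subchart iS' vS'.
  exists (absz (ev v (invmx Q.1 *m r.2) - ht #|S| v)).+1 => k le_k.
  rewrite row_subchart !ev_subchart -/S -/v vP.
  suff lt : ev v Q.2 *+ k + ev v (invmx Q.1 *m r.2) < ev v P.2 *+ k + ht #|S| v.
    by split; [exact: ltW|move=> e; rewrite e ltxx in lt].
  have intn (x : int) : x *+ k = x * k%:Z by rewrite -mulr_natr natz.
  have : k%:Z <= (ev v P.2 - ev v Q.2) * k%:Z.
    by rewrite ler_peMl // -gtz0_ge1 subr_gt0.
  move: le_k; rewrite !intn mulrBl.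
  move: (ev v P.2 * _) (ev v Q.2 * _) (ev v _) (ht _ _) => A B C D; lia.
exists N => _ _ /refineP[P [q [PT qP ->]]] /refineP[Q [r [QT rQ ->]]] j.
have preI (X : chart n) (p : piece) : X \in T -> p \in pat X -> (X, p) \in pre.
  by move=> XT pX; apply/allpairsPdep; exists X, p.
apply: (NP N (leqnn N) (((P, q), (Q, r)), j)).
apply/allpairsP; exists (((P, q), (Q, r)), j); split=> //=; last by rewrite mem_enum.
by apply/allpairsP; exists ((P, q), (Q, r)); rewrite /= !preI.
Qed.

Lemma refine_unimodular N (pat : chart n -> seq piece) :
  (forall P q, P \in T -> q \in pat P -> piece_mx q \in unitmx) ->
  unimodular (refine N T pat).
Proof.
by move=> patu _ /refineP[P [q [PT qP ->]]]; rewrite /subchart /= unitmx_mul (patu P) ?Tu.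
Qed.

Lemma refine_covers (R : realType) N (pat : chart n -> seq piece) :
  (forall P q, P \in T -> q \in pat P -> piece_mx q \in unitmx) ->
  (forall P (c : 'I_n -> R), P \in T -> (forall i, 0 <= c i) ->
    exists2 q, q \in pat P & exists2 d : 'I_n -> R, forall j, 0 <= d j &
      forall i, c i = \sum_j d j * (i \in q.1 j)%:R) ->
  covers R T -> covers R (refine N T pat).
Proof.
move=> patu patc Tcov x; have [P PT /coneP Px] := Tcov x.
have [q qP [d d_ge0 dE]] := patc P _ PT Px.
have P'T : subchart N P q \in refine N T pat by apply/refineP; exists P, q.
exists (subchart N P q) => //; apply/coneP => j.
have P'u := gmx_unit R (refine_unimodular patu) P'T.
suff -> : x = \sum_k (\row_k d k) 0 k *: row k (gmx R (subchart N P q)).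
  by rewrite crd_comb // mxE.
rewrite -[RHS]mulmx_sum_row /gmx /subchart /= map_mxM mulmxA mulmx_sum_row.
rewrite [LHS](crdK x (gmx_unit R Tu PT)); apply: eq_bigr => i _; congr (_ *: _).
by rewrite dE !mxE; apply: eq_bigr => k _; rewrite !mxE; case: (i \in _).
Qed.

End Transport.
End Refine.

(** * Separating by hyperplanes through blow-ups of edges *)

Section EdgeBlowUps.
Variables (R : realType) (n : nat).
Local Notation Z := 'rV[int]_n.
Implicit Types (P Q : chart n) (T : seq (chart n)) (a : 'cV[int]_n) (u v w : Z).

Definition fan_data T := [/\ unimodular T, coherent T & covers R T].

(** Containment of cones, stated by integer functionals so that it is transitive
    without passing to coordinates. *)
Definition inside Q P := forall a,
  (forall i, 0 <= ev (row i P.1) a) -> forall i, 0 <= ev (row i Q.1) a.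

Definition respects a T := forall P, P \in T ->
  (forall i, 0 <= ev (row i P.1) a) \/ (forall i, ev (row i P.1) a <= 0).

Definition subdivides T' T := forall P', P' \in T' -> exists2 P, P \in T & inside P' P.

Lemma evN v a : ev v (- a) = - ev v a.
Proof. by rewrite /ev mulmxN mxE. Qed.

Lemma evDl u v a : ev (u + v) a = ev u a + ev v a.
Proof. by rewrite /ev mulmxDl mxE. Qed.

Lemma subdivides_refl T : subdivides T T.
Proof. by move=> P PT; exists P. Qed.

Lemma subdivides_trans T1 T2 T3 : subdivides T1 T2 -> subdivides T2 T3 -> subdivides T1 T3.
Proof.
move=> s12 s23 P /s12[Q /s23[S ST QS] PQ]; exists S => // a aS.
exact/PQ/QS.
Qed.

Lemma subdivides_respects a T T' : subdivides T' T -> respects a T -> respects a T'.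
Proof.
move=> sT aT P' /sT[P PT P'P]; have [a_ge0|a_le0] := aT P PT.
  by left; exact: P'P.
right=> i; rewrite -oppr_ge0 -evN; apply: (P'P) => k.
by rewrite evN oppr_ge0.
Qed.

Lemma inside_cone Q P : P.1 \in unitmx -> Q.1 \in unitmx -> inside Q P ->
  (cone Q : set 'rV[R]_n) `<=` cone P.
Proof.
move=> Pu Qu QP x /coneP Qx; apply/coneP => i.
rewrite (crdK x (gmx_inv R Qu).1) crd_sum; apply: sumr_ge0 => k _.
rewrite crdZ mulr_ge0 // -of_int_row crd_of_int // ler0z.
have -> : (row k Q.1 *m invmx P.1) 0 i = ev (row k Q.1) (col i (invmx P.1)).
  by rewrite /ev !mxE; apply: eq_bigr => l _; rewrite !mxE.
apply: QP => l; rewrite /ev.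
have -> : (row l P.1 *m col i (invmx P.1)) 0 0 = (P.1 *m invmx P.1) l i.
  by rewrite !mxE; apply: eq_bigr => k' _; rewrite !mxE.
by rewrite mulmxV // mxE.
Qed.

Definition whole_piece : piece n := ([ffun l => [set l]%SET], 0).

Definition split_piece (i j : 'I_n) : piece n :=
  ([ffun l => if l == j then [set i; j]%SET else [set l]%SET], - delta_mx j 0).

Definition edge_pieces u w P : seq (piece n) :=
  if [pick ij : 'I_n * 'I_n | (row ij.1 P.1 == u) && (row ij.2 P.1 == w)] is Some ij
  then [:: split_piece ij.1 ij.2; split_piece ij.2 ij.1] else [:: whole_piece].

Variant edge_spec u w P q : Prop :=
| EdgeWhole of q = whole_piece & ~~ (is_row u P.1 && is_row w P.1)
| EdgeSplit i j of q = split_piece i j & i != j & row i P.1 + row j P.1 = u + w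
    & is_row u P.1 & is_row w P.1 & row j P.1 = u \/ row j P.1 = w.

Lemma edgeP u w P q : u != w -> q \in edge_pieces u w P -> edge_spec u w P q.
Proof.
move=> uw; rewrite /edge_pieces; case: pickP => [[i j] /andP[/= /eqP iu /eqP jw]|no].
  have ij : i != j by apply: contraNneq uw => ij; rewrite -iu -jw ij.
  have uP : is_row u P.1 by apply/is_rowP; exists i.
  have wP : is_row w P.1 by apply/is_rowP; exists j.
  rewrite !inE => /orP[]/eqP ->.
    by apply: (EdgeSplit (i := i) (j := j)) => //; [rewrite iu jw|right].
  apply: (EdgeSplit (i := j) (j := i)) => //; [by rewrite eq_sym|by rewrite iu jw addrC|by left].
rewrite inE => /eqP ->; apply: EdgeWhole => //; apply/negP => /andP[/is_rowP[i iu] /is_rowP[j jw]].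
by have := no (i, j); rewrite /= iu jw !eqxx.
Qed.

Lemma mem_split (K : pzSemiRingType) i j k l : i != j ->
  (l \in (split_piece i j).1 k)%:R = (k == l)%:R + ((k == j) && (l == i))%:R :> K.
Proof.
move=> ij; rewrite ffunE; case: (eqVneq k j) => [->|kj] /=; rewrite !inE.
  have [->|li] := eqVneq l i; first by rewrite ?eqxx [j == i]eq_sym (negbTE ij) add0r.
  by rewrite addr0 eq_sym.
by rewrite addr0 eq_sym.
Qed.

Lemma split_unit i j : i != j -> piece_mx (split_piece i j) \in unitmx.
Proof.
move=> ij; suff -> : piece_mx (split_piece i j) = 1%:M + delta_mx j i.
  suff /mulmx1_unit[] : (1%:M + delta_mx j i) *m (1%:M - delta_mx j i) = 1%:M :> 'M[int]_n by [].
  by rewrite mulmxBr mulmx1 mulmxDl mul1mx mul_delta_mx_0 // addr0 addrK.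
by apply/matrixP => k l; rewrite !mxE mem_split.
Qed.

Lemma whole_unit : piece_mx whole_piece \in unitmx.
Proof.
rewrite (_ : piece_mx _ = 1%:M) ?unitmx1 //.
by apply/matrixP => k l; rewrite !mxE ffunE inE eq_sym.
Qed.

Lemma split_sum i j (S : {set 'I_n}) :
  \sum_(k in S) (split_piece i j).2 k 0 = - (j \in S)%:R.
Proof.
under eq_bigr do rewrite !mxE eqxx andbT.
have [jS|jS] := boolP (j \in S).
  by rewrite (bigD1 j) //= eqxx big1 ?addr0 // => k /andP[_ /negbTE->]; rewrite oppr0.
rewrite big1 ?oppr0 // => k kS; case: eqP kS jS => [->|_ _ _]; last by rewrite oppr0.
by move=> ->.
Qed.

Lemma ssum2 M (i j : 'I_n) : i != j -> ssum [set i; j] M = row i M + row j M.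
Proof. by move=> ij; rewrite /ssum big_setU1 ?inE //= big_set1. Qed.

(** Lowering the support function by 1 at the new ray and nowhere else makes it
    strictly convex along the blow-up. *)
Lemma edge_blowup T u w : fan_data T -> u != w ->
  (exists2 P, P \in T & is_row u P.1 && is_row w P.1) ->
  exists T', [/\ fan_data T', subdivides T' T & forall P', P' \in T' ->
    ~~ (is_row u P'.1 && is_row w P'.1) /\
    exists2 P, P \in T & forall v, is_row v P'.1 ->
      is_row v P.1 \/ [/\ v = u + w, is_row u P.1 & is_row w P.1]].
Proof.
move=> [Tu Tc Tcov] uw [P0 P0T /andP[/is_rowP[i0 ui0] /is_rowP[j0 wj0]]].
have ij0 : i0 != j0 by apply: contraNneq uw => ij; rewrite ui0 wj0 ij.
have g0 : ssum [set i0; j0] P0.1 = u + w by rewrite ssum2 // ui0 wj0.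
have both P S : P \in T -> ssum S P.1 = u + w -> is_row u P.1 && is_row w P.1.
  move=> PT gS; have rows := ssum_common Tc P0T PT (etrans g0 (esym gS)).
  by rewrite ui0 wj0 !rows // !inE eqxx ?orbT.
have edge P S i j : P \in T -> i != j -> row i P.1 + row j P.1 = u + w ->
    ssum S P.1 = u + w -> S = [set i; j]%SET.
  by move=> PT ij uwE gS; apply: (ssum_inj (Tu P PT)); rewrite gS ssum2.
have new_row P i : P \in T -> row i P.1 != u + w.
  move=> PT; apply/eqP => iuw; have := both P [set i]%SET PT.
  rewrite ssum1 => /(_ iuw)/andP[/is_rowP[k uk] /is_rowP[l wl]].
  have kl : k != l by apply: contraNneq uw => kl; rewrite uk wl kl.
  have := edge P [set i]%SET k l PT kl; rewrite ssum1 -uk -wl => /(_ erefl iuw).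
  by move/(congr1 (fun A : {set 'I_n} => #|A|)); rewrite cards1 cards2 kl.
pose pat := edge_pieces u w.
pose ht (c : nat) v : int := if v == u + w then - 1 else 0.
pose occurs (c : nat) v := c = 1%N \/ v = u + w.
have patu P q : P \in T -> q \in pat P -> piece_mx q \in unitmx.
  move=> _ /(edgeP uw)[-> _|i j -> ij _ _ _ _]; [exact: whole_unit|exact: split_unit].
have [N Nc] : exists N, coherent (refine N T pat).
  apply: (refine_coherent Tu Tc (occurs := occurs) (ht := ht)).
  - move=> P q k PT /(edgeP uw)[-> _|i j -> ij ijE _ _ _]; rewrite ffunE.
      by left; rewrite cards1.
    case: ifP => _; last by left; rewrite cards1.
    by right; rewrite ssum2.
  - move=> P q k PT /(edgeP uw)[-> _|i j -> ij ijE _ _ _]; rewrite /ht.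
      rewrite ffunE ssum1 (negbTE (new_row P k PT)) big1 // => l _.
      by rewrite mxE.
    rewrite split_sum mem_split // ffunE.
    case: (eqVneq k j) => [_|kj].
      by rewrite ssum2 // ijE eqxx [j == i]eq_sym (negbTE ij) addr0.
    by rewrite ssum1 (negbTE (new_row P k PT)) addr0 oppr0.
  move=> P q S PT /(edgeP uw) qP VS.
  have VS' : (exists k, S = [set k]%SET) \/ ssum S P.1 = u + w.
    by case: VS => [/eqP/cards1P[k Sk]|]; [left; exists k|right].
  rewrite /ht; case: qP => [-> noP|i j -> ij ijE uP wP jP].
    case: VS' => [[k ->]|gS]; last by have := both P S PT gS; rewrite (negbTE noP).
    rewrite ssum1 (negbTE (new_row P k PT)) big1 // => [|l _]; last by rewrite mxE.
    by split=> // _; exists k; rewrite ffunE.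
  rewrite split_sum; case: VS' => [[k ->]|gS].
    rewrite ssum1 (negbTE (new_row P k PT)) inE eq_sym.
    have [->|kj] := eqVneq k j; first by split.
    by rewrite oppr0; split=> // _; exists k; rewrite ffunE (negbTE kj).
  have -> := edge P S i j PT ij ijE gS.
  rewrite ssum2 // ijE eqxx !inE eqxx orbT; split=> // _.
  by exists j; rewrite ffunE eqxx.
exists (refine N T pat); split.
- split=> //; first exact: refine_unimodular.
  apply: refine_covers => // P c PT c_ge0.
  rewrite /pat /edge_pieces; case: pickP => [[i j] /= /andP[/eqP iu /eqP jw]|_].
    have ij : i != j by apply: contraNneq uw => ij; rewrite -iu -jw ij.
    have cov k l : k != l -> c l <= c k ->
        exists2 d : 'I_n -> R, forall m, 0 <= d m &
        forall m, c m = \sum_m' d m' * (m \in (split_piece k l).1 m')%:R.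
      move=> kl le_c; exists (fun m => if m == k then c k - c l else c m).
        by move=> m; case: eqP => // _; rewrite subr_ge0.
      move=> m; under eq_bigr do rewrite mem_split // mulrDr.
      rewrite big_split /= (bigD1 m) //= eqxx mulr1 big1 => [|m' /negbTE->]; last by rewrite mulr0.
      rewrite addr0 (bigD1 l) //= eqxx big1 => [|m' /negbTE->]; last by rewrite mulr0.
      rewrite addr0 [l == k]eq_sym (negbTE kl) /=.
      have [->|mk] := eqVneq m k; first by rewrite mulr1 subrK.
      by rewrite mulr0 addr0.
    have [le_c|/ltW le_c] := leP (c j) (c i).
      by exists (split_piece i j); [rewrite !inE eqxx|exact: cov].
    by exists (split_piece j i); [rewrite !inE eqxx orbT|apply: cov; rewrite // eq_sym].
  exists whole_piece; first by rewrite inE.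
  exists c => // m; rewrite (bigD1 m) //= ffunE inE eqxx mulr1 big1 ?addr0 // => m' m'm.
  by rewrite ffunE inE eq_sym (negbTE m'm) mulr0.
- move=> _ /refineP[P [q [PT _ ->]]]; exists P => // a a_ge0 k.
  by rewrite row_subchart ev_sum; apply: sumr_ge0.
move=> _ /refineP[P [q [PT qP ->]]].
have rowsP v : is_row v (subchart N P q).1 -> exists k, v = ssum (q.1 k) P.1.
  by move=> /is_rowP[k ->]; exists k; rewrite row_subchart.
case: (edgeP uw qP) => [qE noP|i j qE ij ijE uP wP jP].
  have sub v : is_row v (subchart N P q).1 -> is_row v P.1.
    by move=> /rowsP[k ->]; apply/is_rowP; exists k; rewrite qE ffunE ssum1.
  split; last by exists P => // v /sub; left.
  by apply: contra noP => /andP[/sub-> /sub->].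
split; last first.
  exists P => // v /rowsP[k ->]; rewrite qE ffunE; case: ifP => _.
    by right; split=> //; rewrite ssum2.
  by left; apply/is_rowP; exists k; rewrite ssum1.
have : ~~ is_row (row j P.1) (subchart N P q).1.
  apply/negP => /rowsP[k]; rewrite -ssum1 => /(ssum_inj (Tu P PT)).
  rewrite qE ffunE; case: (eqVneq k j) => [_|kj].
    by move/(congr1 (fun A : {set 'I_n} => #|A|)); rewrite cards1 cards2 ij.
  by move/set1P: (set11 j) => _ /finset.setP/(_ j); rewrite !inE eqxx eq_sym (negbTE kj).
by case: jP => ->; [move/negbTE->|move/negbTE->; rewrite andbF].
Qed.

Definition crossing T a y z :=
  (exists2 P, P \in T & is_row y P.1 && is_row z P.1) /\ ev z a < 0 < ev y a.

(** De Concini and Procesi: blowing up a crossing edge of maximal spread creates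
    only crossing edges of smaller spread. *)
Lemma crossing_edge_blowup T a u w (D : int) : fan_data T -> crossing T a u w ->
  ev u a - ev w a = D -> (forall y z, crossing T a y z -> ev y a - ev z a <= D) ->
  exists T', [/\ fan_data T', subdivides T' T,
    forall y z, crossing T' a y z -> ev y a - ev z a <= D &
    forall y z, crossing T' a y z -> ev y a - ev z a = D ->
      crossing T a y z /\ (y, z) != (u, w)].
Proof.
move=> okT [PT /andP[w_lt0 u_gt0]] uwD maxD.
have uw : u != w by apply: contraTneq w_lt0 => <-; rewrite -leNgt ltW.
have [T' [okT' subT' T'P]] := edge_blowup okT uw PT.
have key y z : crossing T' a y z ->
    ev y a - ev z a < D \/ crossing T a y z /\ (y, z) != (u, w).
  move=> [[P' /T'P[noP' [P QT rows]] /andP[yP' zP']] /andP[z_lt0 y_gt0]].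
  have cr x x' : is_row x P.1 -> is_row x' P.1 -> ev x' a < 0 -> 0 < ev x a ->
      crossing T a x x'.
    by move=> xP x'P x'0 x0; split; [exists P => //; rewrite xP|rewrite x0 x'0].
  have [yP|[yE uP wP]] := rows y yP'; have [zP|[zE uP' wP']] := rows z zP'.
  - right; split; first exact: cr.
    by apply: contraNneq noP' => -[<- <-]; rewrite yP'.
  - left; have := maxD _ _ (cr _ _ yP wP' w_lt0 y_gt0).
    by move: z_lt0; rewrite zE !evDl; lia.
  - left; have := maxD _ _ (cr _ _ uP zP z_lt0 u_gt0).
    by move: y_gt0; rewrite yE !evDl; lia.
  - by move: z_lt0 y_gt0; rewrite yE zE; lia.
exists T'; split=> // y z /key[lt_D|[/maxD//]].
- exact: ltW.
- by move=> e; rewrite e ltxx in lt_D.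
Qed.

Definition rows_of T : seq Z := [seq row i P.1 | P <- T, i <- enum 'I_n].

Lemma mem_rows_of T P v : P \in T -> is_row v P.1 -> v \in rows_of T.
Proof.
move=> PT /is_rowP[i ->]; apply/allpairsP; exists (P, i).
by rewrite mem_enum PT.
Qed.

Lemma crossing_mem T a y z : crossing T a y z ->
  (y, z) \in [seq (u, w) | u <- rows_of T, w <- rows_of T].
Proof.
move=> [[P PT /andP[yP zP]] _]; apply/allpairsP; exists (y, z).
by split=> //=; exact: mem_rows_of PT _.
Qed.

Lemma respect_functional T a : fan_data T ->
  exists T', [/\ fan_data T', subdivides T' T & respects a T'].
Proof.
move=> okT.
(* Outer induction on a bound for the spread, inner induction on a list of pairs
   that contains all crossing edges attaining it. *)
suff bounded (D : nat) : forall T, fan_data T ->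
    (forall y z, crossing T a y z -> ev y a - ev z a <= D%:Z) ->
    exists T', [/\ fan_data T', subdivides T' T & respects a T'].
  apply: (bounded (\max_(p <- [seq (u, w) | u <- rows_of T, w <- rows_of T])
    absz (ev p.1 a - ev p.2 a))%N) => // y z /crossing_mem yz.
  apply: (le_trans (lez_abs _)); rewrite lez_nat.
  exact: (leq_bigmax_seq (F := fun p : Z * Z => absz (ev p.1 a - ev p.2 a)) _ yz).
elim: D => [|D IHD] {okT}T okT maxD.
  exists T; split=> //; first exact: subdivides_refl.
  move=> P PT.
  have [|/existsNP[i /negP]] := pselect (forall i, 0 <= ev (row i P.1) a); first by left.
  rewrite -ltNge => i_lt0; right=> j; rewrite leNgt; apply/negP => j_gt0.
  have : crossing T a (row j P.1) (row i P.1).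
    split; last by rewrite i_lt0.
    by exists P => //; apply/andP; split; apply/is_rowP; eexists.
  by move/maxD; lia.
suff maxlist (S : seq (Z * Z)) : forall T, fan_data T ->
    (forall y z, crossing T a y z -> ev y a - ev z a <= D.+1%:Z) ->
    (forall y z, crossing T a y z -> ev y a - ev z a = D.+1%:Z -> (y, z) \in S) ->
    exists T', [/\ fan_data T', subdivides T' T & respects a T'].
  by apply: (maxlist _ T okT maxD) => y z /crossing_mem + _; apply.
elim: S => [|[u w] S IHS] {okT maxD}T okT maxD inS.
  apply: IHD => // y z yz; have := maxD y z yz; have := inS y z yz.
  by rewrite in_nil le_eqVlt => no /orP[/eqP/no //|]; lia.
have [[uwT uwD]|no] := pselect (crossing T a u w /\ ev u a - ev w a = D.+1%:Z).
  have [T1 [okT1 sub1 max1 in1]] := crossing_edge_blowup okT uwT uwD maxD.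
  have [|T2 [okT2 sub2 res2]] := IHS T1 okT1 max1.
    move=> y z yz yzD; have [yzT yz_uw] := in1 y z yz yzD.
    by have := inS y z yzT yzD; rewrite inE (negbTE yz_uw).
  by exists T2; split=> //; exact: subdivides_trans sub2 sub1.
apply: IHS => // y z yz yzD; have := inS y z yz yzD.
rewrite inE => /orP[/eqP[yu zw]|//].
by case: no; rewrite -yu -zw.
Qed.

Lemma respect_functionals T (L : seq 'cV[int]_n) : fan_data T ->
  exists T', [/\ fan_data T', subdivides T' T & forall a, a \in L -> respects a T'].
Proof.
move=> okT; elim: L => [|a L [T1 [ok1 sub1 res1]]].
  by exists T; split=> //; exact: subdivides_refl.
have [T2 [ok2 sub2 res2]] := respect_functional a ok1.
exists T2; split=> //; first exact: subdivides_trans sub2 sub1.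
move=> b; rewrite inE => /orP[/eqP->//|/res1].
exact: subdivides_respects.
Qed.

(** The sum of absolute values is convex and linear exactly on the orthants. *)
Lemma orthants : exists T, fan_data T.
Proof.
pose sg (e : {ffun 'I_n -> bool}) : Z := \row_i (-1) ^+ e i.
pose chart_of e : chart n := (diag_mx (sg e), (sg e)^T).
have sg2 e : diag_mx (sg e) *m diag_mx (sg e) = 1%:M.
  apply/matrixP => i j; rewrite mul_diag_mx !mxE mulrnAr.
  by case: eqP => // ->; rewrite -signr_addb addbb.
have row_sg e i : row i (diag_mx (sg e)) = (-1) ^+ e i *: delta_mx 0 i.
  by apply/rowP => j; rewrite !mxE eqxx eq_sym /= mulr_natr.
have Tu : unimodular (map chart_of (enum {ffun 'I_n -> bool})).
  by move=> _ /mapP[e _ ->]; have [] := mulmx1_unit (sg2 e).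
exists (map chart_of (enum {ffun 'I_n -> bool})); split=> //.
- move=> _ _ /mapP[e _ ->] /mapP[f _ ->] i; rewrite /= !row_sg.
  have evE h : ev ((-1) ^+ e i *: delta_mx 0 i) (sg h)^T = (-1) ^+ (e i (+) h i).
    by rewrite /ev -scalemxAl mxE -rowE !mxE -signr_addb.
  rewrite !evE addbb; have [ef|ef] := eqVneq (e i) (f i).
    rewrite ef addbb; split=> // _; apply/is_rowP; exists i.
    by rewrite /= row_sg.
  by have -> : e i (+) f i by case: (e i) (f i) ef => [] [].
move=> x; pose e := [ffun i => x 0 i < 0].
have eT : chart_of e \in map chart_of (enum {ffun 'I_n -> bool}).
  by apply: map_f; rewrite mem_enum.
exists (chart_of e) => //; apply/coneP => i; have Gu := gmx_unit R Tu eT.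
suff -> : x = \sum_k (\row_k `|x 0 k|) 0 k *: row k (gmx R (chart_of e)).
  by rewrite crd_comb // mxE.
rewrite -mulmx_sum_row /gmx map_diag_mx mul_mx_diag.
apply/rowP => k; rewrite !mxE rmorph_sign ffunE.
case: ltP => [x0|x0]; first by rewrite ltr0_norm // expr1 mulrN mulr1 opprK.
by rewrite ger0_norm // expr0 mulr1.
Qed.

End EdgeBlowUps.

(** * The last subdivision *)

Section FinalSubdivision.
Local Notation I3 := 'I_3.
Implicit Types (S : {set I3}) (i j k l : I3).

(** The six cones of the last subdivision, in local coordinates. For each i there
    are a corner, spanned by e_i and the two sums e_i + e_j, and a part of the
    middle cone, in which e_i is replaced by e_0 + e_1 + e_2. The middle cone has
    determinant two, and its centre e_0 + e_1 + e_2 is half the sum of its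
    generators, which is why cutting it there is not a blow-up. The heights 0, -4
    and -7 of sums of one, two and three generators make the subdivision strictly
    convex: the last must lie strictly between -8 and -6, the values at the centre
    of the functionals of a corner and of the uncut middle cone. *)
Definition corner_piece i : piece 3 :=
  ([ffun j => [set i; j]%SET], \col_j if j == i then 0 else - 4).

Definition inner_piece i : piece 3 :=
  ([ffun j => if j == i then [set: I3]%SET else [set i; j]%SET],
   \col_j if j == i then - 1 else - 3).

Definition final_pieces (P : chart 3) : seq (piece 3) :=
  map corner_piece (enum I3) ++ map inner_piece (enum I3).

Lemma final_piecesP P q : reflect (exists i, q = corner_piece i \/ q = inner_piece i)
  (q \in final_pieces P).
Proof.
rewrite mem_cat; apply: (iffP orP) => [[]/mapP[i _ ->]|[i [->|->]]].
- by exists i; left.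
- by exists i; right.
- by left; apply: map_f; rewrite mem_enum.
- by right; apply: map_f; rewrite mem_enum.
Qed.

Lemma card_le3 S : (#|S| <= 3)%N.
Proof. by rewrite -[X in (_ <= X)%N](card_ord 3) max_card. Qed.

Lemma card3 S : #|S| = 3 -> S = [set: I3]%SET.
Proof. by move=> S3; apply/eqP; rewrite eqEcard finset.subsetT cardsT card_ord S3. Qed.

Lemma card2 S i : #|S| = 2 -> i \in S -> exists2 j, j != i & S = [set i; j]%SET.
Proof.
move=> S2 iS; have : #|S :\ i| = 1%N by rewrite [#|S|](cardsD1 i) iS in S2; case: S2.
move=> /eqP/cards1P[j Sj]; exists j; last by rewrite -(finset.setD1K iS) Sj.
have : j \in (S :\ i)%SET by rewrite Sj finset.set11.
by rewrite !inE => /andP[].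
Qed.

Lemma corner_unit i : piece_mx (corner_piece i) \in unitmx.
Proof.
(* The inverse matrix: e_j = (e_i + e_j) - e_i. *)
pose B : 'M[int]_3 := \matrix_(j, k) ((j == k)%:R - ((j != i) && (k == i))%:R).
suff /mulmx1_unit[] : B *m piece_mx (corner_piece i) = 1%:M by [].
apply/matrixP => j k; rewrite !mxE.
rewrite 3!big_ord_recl big_ord0 !mxE !ffunE !inE.
by case: i j k @B => [[|[|[|//]]] ?] [[|[|[|//]]] ?] [[|[|[|//]]] ?].
Qed.

Lemma inner_unit i : piece_mx (inner_piece i) \in unitmx.
Proof.
(* The inverse matrix, with l the third index and b the centre:
   e_i = (e_i + e_j) + (e_i + e_l) - b and e_j = b - (e_i + e_l). *)
pose B : 'M[int]_3 := \matrix_(j, k)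
  if j == i then (if k == i then - 1 else 1)
  else if k == i then 1 else if k == j then 0 else - 1.
suff /mulmx1_unit[] : B *m piece_mx (inner_piece i) = 1%:M by [].
apply/matrixP => j k; rewrite !mxE.
rewrite 3!big_ord_recl big_ord0 !mxE !ffunE.
by case: i j k @B => [[|[|[|//]]] ?] [[|[|[|//]]] ?] [[|[|[|//]]] ?]; rewrite /= !inE.
Qed.

Lemma sum_if_eq S i (x y : int) :
  \sum_(j in S) (if j == i then x else y) = y * #|S|%:Z + (x - y) * (i \in S)%:R.
Proof.
have -> : \sum_(j in S) (if j == i then x else y) =
    \sum_(j in S) (y + (if j == i then x - y else 0)).
  by apply: eq_bigr => j _; case: eqP; rewrite ?addr0 // addrC subrK.
rewrite big_split /= sumr_const -[y *+ _]mulr_natr natz; congr (_ + _).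
have [iS|iS] := boolP (i \in S); last first.
  by rewrite mulr0 big1 // => j jS; case: eqP jS iS => // -> ->.
by rewrite mulr1 (bigD1 i) //= eqxx big1 ?addr0 // => j /andP[_ /negbTE->].
Qed.

Definition height (c : nat) (v : 'rV[int]_3) : int :=
  if c == 1%N then 0 else if c == 2%N then - 4 else - 7.

Variable R : realType.

Section Step.
Variable T : seq (chart 3).
Hypothesis okT : fan_data R T.

Let Tu : unimodular T. Proof. by case: okT. Qed.
Let Tc : coherent T. Proof. by case: okT. Qed.

Lemma final_unit P q : P \in T -> q \in final_pieces P -> piece_mx q \in unitmx.
Proof. by move=> _ /final_piecesP[i [->|->]]; [exact: corner_unit|exact: inner_unit]. Qed.

Lemma final_coherent : exists N, coherent (refine N T final_pieces).
Proof.
apply: (refine_coherent Tu Tc (occurs := fun c _ => (0 < c)%N) (ht := height)).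
- move=> P q j _ /final_piecesP[i [->|->]]; rewrite ffunE ?cards2 //.
  by case: ifP => _; rewrite ?cardsT ?card_ord ?cards2.
- move=> P q j _ /final_piecesP[i [->|->]]; under eq_bigr do rewrite mxE; rewrite sum_if_eq ffunE.
    by rewrite cards2 !inE eqxx /height; case: eqP.
  rewrite /height; case: (eqVneq j i) => ji; first by rewrite cardsT card_ord inE.
  by rewrite cards2 !inE eqxx eq_sym ji.
move=> P q S _ /final_piecesP[i iq] S_gt0.
have S3 := card_le3 S; rewrite /height.
case: iq => ->; under eq_bigr do rewrite mxE; rewrite sum_if_eq.
- have [iS|iS] := boolP (i \in S).
    case: #|S| S_gt0 S3 (@card2 S i) (@cards1P _ S) => [//|[|[|[|//]]]] _ _ S2 S1.
    + split=> // _; exists i; rewrite ffunE finset.setUid.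
      by have [j Sj] := elimT S1 isT; move: iS; rewrite Sj inE => /eqP ->.
    + by split=> // _; have [//|//|j _ ->] := S2; exists j; rewrite ffunE.
    + by split.
  by case: #|S| S_gt0 S3 => [|[|[|[|]]]] //= _ _; split.
have [iS|iS] := boolP (i \in S).
  case: #|S| S_gt0 S3 (@card2 S i) (@card3 S) => [//|[|[|[|//]]]] _ _ S2 S1.
  + by split.
  + by split=> // _; have [//|//|j ji ->] := S2; exists j; rewrite ffunE (negbTE ji).
  + by split=> // _; exists i; rewrite ffunE eqxx S1.
by case: #|S| S_gt0 S3 => [|[|[|[|]]]] //= _ _; split.
Qed.

Lemma final_covers N : covers R (refine N T final_pieces).
Proof.
apply: (refine_covers Tu N final_unit); last by case: okT.
move=> P c _ c_ge0; pose s := \sum_j c j.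
have [i c_max] : exists i, forall j, c j <= c i.
  case: (@arg_maxP _ _ _ ord0 xpredT c) => // i _ c_max.
  by exists i => j; exact: c_max.
(* A point belongs to the corner at its largest coordinate if that is at least the
   sum of the others, and to the middle cone otherwise. *)
have sD1 : s = c i + \sum_(j | j != i) c j by rewrite /s (bigD1 i).
have [le_c|/ltW le_c] := leP s (c i *+ 2).
  exists (corner_piece i); first by apply/final_piecesP; exists i; left.
  exists (fun j => if j == i then c i *+ 2 - s else c j).
    by move=> j; case: eqP => // _; rewrite subr_ge0.
  move=> m; have [->|mi] := eqVneq m i.
    under eq_bigr do rewrite ffunE !inE eqxx mulr1.
    rewrite (bigD1 i) //= eqxx sD1; set t := \sum_(_ | _) _.
    have -> : \sum_(j | j != i) (if j == i then c i *+ 2 - (c i + t) else c j) = t.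
      by apply: eq_bigr => j /negbTE->.
    by rewrite mulr2n; ring.
  rewrite (bigD1 m) //= (negbTE mi) ffunE !inE eqxx orbT mulr1 big1 ?addr0 // => j jm.
  by rewrite ffunE !inE (negbTE mi) [m == j]eq_sym (negbTE jm) mulr0.
exists (inner_piece i); first by apply/final_piecesP; exists i; right.
exists (fun j => if j == i then s - c i *+ 2 else c i *+ 2 + c j - s).
  move=> j; case: eqP => [_|/eqP ji]; first by rewrite subr_ge0.
  have -> : s = c i + (c j + \sum_(k | (k != i) && (k != j)) c k).
    by rewrite sD1 (bigD1 j).
  suff : \sum_(k | (k != i) && (k != j)) c k <= c i by lra.
  apply: le_trans (ler_sum (G := fun _ => c i) _ _) _ => [k _|]; first exact: c_max.
  rewrite sumr_const (_ : #|_| = 1%N) // -sum1_card big_mkcond !big_ord_recl big_ord0.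
  by case: i j ji {c_max sD1 le_c} => [[|[|[|//]]] ?] [[|[|[|//]]] ?].
move=> m; have [->|mi] := eqVneq m i.
  rewrite (bigD1 i) //= eqxx ffunE eqxx inE mulr1.
  have -> : \sum_(j | j != i) (if j == i then s - c i *+ 2 else c i *+ 2 + c j - s) *
      (i \in (inner_piece i).1 j)%:R = \sum_(j | j != i) ((c i *+ 2 - s) + c j).
    apply: eq_bigr => j /negbTE ji; rewrite ji ffunE ji !inE eqxx mulr1; ring.
  rewrite big_split /= sumr_const cardC1 card_ord.
  by move: sD1; set t := \sum_(_ | _) c _ => ->; rewrite /= !mulr2n; ring.
rewrite (bigD1 i) //= eqxx ffunE eqxx inE mulr1 (bigD1 m) //=.
rewrite (negbTE mi) ffunE (negbTE mi) !inE eqxx orbT mulr1 big1.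
  by rewrite addr0; ring.
move=> j /andP[ji jm]; rewrite ffunE (negbTE ji) !inE (negbTE mi) [m == j]eq_sym (negbTE jm).
by rewrite mulr0.
Qed.

Lemma final_subdivides N : subdivides (refine N T final_pieces) T.
Proof.
move=> _ /refineP[P [q [PT _ ->]]]; exists P => // a a_ge0 k.
by rewrite row_subchart ev_sum; apply: sumr_ge0.
Qed.

Hypothesis Tcoord : forall c, respects (delta_mx c 0) T.

Lemma ev_sum_ge (s : seq 'rV[int]_3) (m : 'cV[int]_3) d y :
  uniq s -> (2 <= size s)%N -> y \in s -> 0 <= d ->
  (forall u, u \in s -> d <= ev u m) -> ev y m + d <= ev (\sum_(u <- s) u) m.
Proof.
move=> us s2 ys d_ge0 s_ge; rewrite ev_sum (big_rem y) //= lerD2l.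
have : (0 < size (rem y s))%N by rewrite size_rem // -subn1 subn_gt0.
have rs z : z \in rem y s -> z \in s by exact: mem_rem.
case: (rem y s) rs => // z r rs _; rewrite big_cons -[d]addr0 lerD //.
  by apply: s_ge; apply: rs; rewrite inE eqxx.
rewrite big_seq; apply: sumr_ge0 => v vr; apply: le_trans (s_ge v _) => //.
by apply: rs; rewrite inE vr orbT.
Qed.

Lemma piece_nonempty P q j : q \in final_pieces P -> (0 < #|q.1 j|)%N.
Proof.
move=> /final_piecesP[i [->|->]]; rewrite ffunE ?cards2 //.
by case: ifP => _; rewrite ?cardsT ?card_ord ?cards2.
Qed.

Lemma piece_singleton P q j k l : q \in final_pieces P ->
  q.1 j = [set l]%SET -> l \in q.1 k.
Proof.
move=> /final_piecesP[i [->|->]]; rewrite !ffunE.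
  by move=> /finset.setP/(_ i); rewrite !inE eqxx => /esym/eqP->; rewrite eqxx.
case: (eqVneq j i) => [_|ji] /(congr1 (fun A : {set I3} => #|A|)).
  by rewrite cardsT card_ord cards1.
by rewrite cards2 eq_sym ji cards1.
Qed.

(** A ray g created by a blow-up is a sum of at least two of its neighbours, and
    these are too heavy. If g was a ray before the last subdivision, its neighbours
    now are sums of g and something in the same orthant, so any coordinate of g that
    is nonzero is too large in their sum. Otherwise g is the sum of two or three
    generators of a cone P, those indexed by S0; the cones at g inside P leave for the members of s only
    sums whose total number of generators exceeds that of g. *)
Lemma final_not_blowup N : coherent (refine N T final_pieces) ->
  ~ exists Sigma0 : set (set 'rV[R]_3),
    [/\ is_fan Sigma0, unimodular_fan Sigma0
      & is_blowup (fan_of (refine N T final_pieces)) Sigma0].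
Proof.
set T' := refine N T final_pieces => T'c [Sigma0 [fan0 [_ simp0 _ _] blow]].
have T'u : unimodular T' := refine_unimodular Tu (@final_unit).
have [s [us s2 gs nbr rows]] := blowup_rows T'u T'c fan0 simp0 blow.
set g := \sum_(u <- s) u in gs nbr rows.
have other b : exists2 v, v \in s & v != b.
  apply: contrapT => no; have : (size s <= size [:: b])%N.
    apply: uniq_leq_size => // v vs; rewrite inE; apply: contrapT => /negP vb.
    by apply: no; exists v.
  by rewrite /= leqNgt s2.
have [u0 u0s _] := other 0.
have [_ [/refineP[P [q [PT qP ->]]] /is_rowP[j0 +] _]] := nbr u0 u0s.
rewrite row_subchart; have : (0 < #|q.1 j0|)%N := piece_nonempty j0 qP.
move: (q.1 j0) => S0 S0_gt0 gS {q qP j0}.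
have wS S : ev (ssum S P.1) (invmx P.1 *m const_mx 1) = #|S|%:Z.
  rewrite ev_ssum_local ?Tu //; under eq_bigr do rewrite mxE.
  by rewrite sumr_const natz.
pose wt v := ev v (invmx P.1 *m const_mx 1).
have wg : wt g = #|S0|%:Z by rewrite /wt gS wS.
have cornerT i : subchart N P (corner_piece i) \in T'.
  by apply/refineP; exists P, (corner_piece i); split=> //; apply/final_piecesP; exists i; left.
have innerT i : subchart N P (inner_piece i) \in T'.
  by apply/refineP; exists P, (inner_piece i); split=> //; apply/final_piecesP; exists i; right.
have g_corner i j : S0 = [set i; j]%SET -> is_row g (subchart N P (corner_piece i)).1.
  by move=> S0E; apply/is_rowP; exists j; rewrite row_subchart ffunE gS S0E.
have g_inner i j : j != i -> S0 = [set i; j]%SET -> is_row g (subchart N P (inner_piece i)).1.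
  by move=> ji S0E; apply/is_rowP; exists j; rewrite row_subchart ffunE gS S0E (negbTE ji).
have : (#|S0| = 1 \/ #|S0| = 2 \/ #|S0| = 3)%N by have := card_le3 S0; lia.
move=> [S1|[S2|S3]].
- (* g is an old ray; a is a coordinate, up to sign, positive on g. *)
  have /eqP/cards1P[i S0i] := S1; rewrite S0i ssum1 in gS.
  have g0 : g != 0.
    apply/eqP => g0; have := wg; rewrite S1 g0 /wt /ev mul0mx mxE; lia.
  have [c gc] : exists c, g 0 c != 0.
    apply: contrapT => no; case/eqP: g0; apply/rowP => c; rewrite mxE.
    by apply: contrapT => /eqP gc; apply: no; exists c.
  have [a [aT ag]] : exists a, respects a T /\ 0 < ev g a.
    have evE v : ev v (delta_mx c 0) = v 0 c by rewrite /ev -colE mxE.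
    have [gc0|gc0] : 0 < g 0 c \/ g 0 c < 0 by move: gc; lia.
      by exists (delta_mx c 0); rewrite evE.
    exists (- delta_mx c 0); rewrite evN evE oppr_gt0; split=> // Q QT.
    by case: (Tcoord c QT) => sgn; [right|left] => k; rewrite evN ?oppr_le0 ?oppr_ge0.
  have a_ge u : u \in s -> ev g a <= ev u a.
    move=> /nbr[_ [/refineP[Q [r [QT rQ ->]]] /is_rowP[k gk] /is_rowP[k' ->]]].
    rewrite row_subchart in gk; rewrite row_subchart.
    have /is_rowP[l gl] : is_row (row i P.1) Q.1.
      apply: (@ssum_common _ T Tc P Q [set i]%SET (r.1 k)) => //; last by rewrite inE.
      by rewrite ssum1 -gS.
    rewrite -gS in gl; have rk : r.1 k = [set l]%SET.
      by apply: (ssum_inj (Tu QT)); rewrite -gk ssum1.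
    have lk' : l \in r.1 k' by exact: piece_singleton rQ rk.
    have [Q_ge0|/(_ l)] := aT Q QT; last by rewrite -gl leNgt ag.
    rewrite [leRHS]ev_sum (bigD1 l) //= -gl lerDl; apply: sumr_ge0 => m _; exact: Q_ge0.
  have := ev_sum_ge us s2 u0s (ltW ag) a_ge; rewrite -/g.
  have := a_ge _ u0s; move: ag; lia.
- (* g = e_i + e_j. The corner at i and the middle part at j, both containing g,
     share no other generator, so together they account for all members of s;
     those in the middle part have weight at least 2. *)
  have [i iS0] : exists i, i \in S0 by apply/card_gt0P.
  have [j ji S0ij] := card2 S2 iS0.
  have S0ji : S0 = [set j; i]%SET by rewrite S0ij finset.setUC.
  have ij : i != j by rewrite eq_sym.
  have [b1 _ rows1] := rows _ (cornerT i) (g_corner i j S0ij).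
  have [b2 _ rows2] := rows _ (innerT j) (g_inner j i ij S0ji).
  have in1 u : u \in s -> u != b1 -> exists2 k, k != j & u = ssum [set i; k] P.1.
    move=> us' ub1; have /is_rowP[k uk] := rows1 u us' ub1.
    rewrite row_subchart ffunE in uk; exists k => //.
    by apply: contraNneq gs => kj; rewrite gS S0ij -kj -uk.
  have in2 u : u \in s -> u != b2 ->
      u = ssum [set: I3] P.1 \/ exists2 k, k != i & k != j /\ u = ssum [set j; k] P.1.
    move=> us' ub2; have /is_rowP[k uk] := rows2 u us' ub2.
    rewrite row_subchart ffunE in uk; case: (eqVneq k j) uk => [_|kj] uk; first by left.
    right; exists k => //.
    by apply: contraNneq gs => ki; rewrite gS S0ji -ki -uk.
  have in12 u : u \in s -> u != b1 -> u != b2 -> False.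
    move=> us' ub1 /(in2 u us'); have [k kj ->] := in1 u us' ub1.
    case=> [|[l _ [lj]]] /(ssum_inj (Tu PT)).
      by move/(congr1 (fun A : {set I3} => #|A|)); rewrite cardsT card_ord cards2; case: eqP.
    by move/finset.setP/(_ j); rewrite !inE eqxx [j == i]eq_sym (negbTE ij) eq_sym (negbTE kj).
  have b12 : b1 != b2.
    apply/eqP => b12; have [u us' ub] := other b1; apply: (in12 u) => //.
    by rewrite -b12.
  have wt_ge1 u : u \in s -> 1 <= wt u.
    move=> us'; have [ub1|ub1] := eqVneq u b1.
      have ub2 : u != b2 by rewrite ub1.
      case: (in2 u us' ub2) => [->|[k _ [_ ->]]]; rewrite /wt wS ?cards2 //.
      by rewrite cardsT card_ord.
    by have [k _ ->] := in1 u us' ub1; rewrite /wt wS cards2.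
  have [y ys yb2] := other b2.
  have wy : 2 <= wt y.
    case: (in2 y ys yb2) => [->|[k _ [kj ->]]]; rewrite /wt wS.
      by rewrite cardsT card_ord.
    by rewrite cards2 eq_sym kj.
  have := ev_sum_ge us s2 ys ler01 wt_ge1.
  by move: wg wy; rewrite S2 /wt -/g; lia.
(* g is the centre. A member of s that is not a sum of two generators would be the
   one missing from each of the three parts of the middle cone, so any other member
   would belong to all three, but no sum of two generators does. *)
have g_T i : is_row g (subchart N P (inner_piece i)).1.
  apply/is_rowP; exists i; rewrite row_subchart ffunE eqxx gS.
  by rewrite (card3 S3).
have in_i i : exists b, forall u, u \in s -> u != b -> exists2 k, k != i & u = ssum [set i; k] P.1.
  have [b _ rowsi] := rows _ (innerT i) (g_T i).
  exists b => u us' /(rowsi u us')/is_rowP[k uk]; rewrite row_subchart ffunE in uk.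
  case: (eqVneq k i) uk => [_ uT|ki ->]; last by exists k.
  by case/negP: gs; rewrite gS (card3 S3) -uT.
have wt_ge2 u : u \in s -> 2 <= wt u.
  move=> us'; have [[i [k ki ->]]|no] :=
    pselect (exists i, exists2 k, k != i & u = ssum [set i; k] P.1).
    by rewrite /wt wS cards2 eq_sym ki.
  have [y ys yu] := other u.
  have yi i : exists2 k, k != i & y = ssum [set i; k] P.1.
    have [b bP] := in_i i; apply: (bP) => //.
    apply: contraNneq yu => ->; rewrite eq_sym; apply: contraT => ub.
    by case: no; exists i; exact: bP.
  have [k k0 yk] := yi ord0; have [l [l0 lk]] : exists l : I3, l != ord0 /\ l != k.
    have [->|k1] := eqVneq k (@Ordinal 3 1 isT); first by exists (@Ordinal 3 2 isT).
    by exists (@Ordinal 3 1 isT); split=> //; rewrite eq_sym.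
  have [m ml] := yi l; rewrite yk => /(ssum_inj (Tu PT))/finset.setP/(_ l).
  by rewrite !inE eqxx (negbTE l0) (negbTE lk).
have := ev_sum_ge us s2 u0s (ler0n _ 2) wt_ge2.
by have := wt_ge2 _ u0s; move: wg; rewrite S3 /wt -/g; lia.
Qed.

End Step.
End FinalSubdivision.

(** * Rational hyperplanes and the refinement of a fan *)

Section Hyperplanes.
Variables (R : realType) (n : nat).
Local Notation V := 'rV[R]_n.

Lemma argmin_seq (U : eqType) (s : seq U) (f : U -> R) : s != [::] ->
  exists2 u, u \in s & forall v, v \in s -> f u <= f v.
Proof.
elim: s => // u [|w s] IHs _; first by exists u => // [|v]; rewrite inE // => /eqP->.
have [//|v vs minv] := IHs; have [uv|/ltW vu] := leP (f u) (f v).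
  exists u; first by rewrite inE eqxx.
  move=> x; rewrite inE => /orP[/eqP->//|/minv]; exact: le_trans.
exists v; first by rewrite inE vs orbT.
by move=> x; rewrite inE => /orP[/eqP->//|/minv].
Qed.

(** Minkowski-Weyl by Fourier-Motzkin elimination: adding a generator v to a cone
    keeps the inequalities that are nonnegative on v and combines each of the
    positive with each of the negative ones into one vanishing on v. *)
Lemma polyhedral_cone_ineqs (C : set V) : polyhedral_cone C ->
  exists L : seq V, forall x, C x <-> forall a, a \in L -> 0 <= dot a x.
Proof.
move=> [s ->{C}]; elim: s => [|v s [L LE]].
  exists ([seq delta_mx 0 j | j <- enum 'I_n] ++ [seq - delta_mx 0 j | j <- enum 'I_n]).
  have dotd j x : dot (delta_mx 0 j) x = x 0 j.
    rewrite /dot (bigD1 j) //= mxE !eqxx mul1r big1 ?addr0 // => k kj.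
    by rewrite mxE eqxx (negbTE kj) mul0r.
  move=> x; split.
    move: x; apply: Cone_min; last by move=> y; rewrite /= in_nil.
    split=> [a _|x y x0 y0 a aL|t x t0 x0 a aL]; rewrite ?dot0r ?dotDr ?dotZr //.
      by rewrite addr_ge0 ?x0 ?y0.
    by rewrite mulr_ge0 ?x0.
  move=> x0; have -> : x = 0; last by case: (convex_cone_Cone [set` ([::] : seq V)]).
  apply/rowP => j; rewrite [RHS]mxE; apply/eqP; rewrite eq_le; apply/andP; split.
    rewrite -oppr_ge0 -dotd dotC -mulN1r -dotZr scaleN1r dotC.
    by apply: x0; rewrite mem_cat; apply/orP; right; apply/mapP; exists j; rewrite ?mem_enum.
  rewrite -dotd; apply: x0; rewrite mem_cat; apply/orP; left.
  by apply/mapP; exists j; rewrite ?mem_enum.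
have dotBZl (p q : V) c d x : dot (c *: q - d *: p) x = c * dot q x - d * dot p x.
  by rewrite dotC dotBr !dotZr !(dotC x).
exists ([seq a <- L | 0 <= dot a v] ++
  [seq dot p v *: q - dot q v *: p | p <- [seq p <- L | 0 < dot p v],
                                     q <- [seq q <- L | dot q v < 0]]).
move=> x; split.
  move: x; apply: Cone_min.
    split=> [a _|x y x0 y0 a aL|t x t0 x0 a aL]; rewrite ?dot0r ?dotDr ?dotZr //.
      by rewrite addr_ge0 ?x0 ?y0.
    by rewrite mulr_ge0 ?x0.
  move=> y; rewrite /= inE => ys a; rewrite mem_cat mem_filter => /orP[/andP[av aL]|].
    case/orP: ys => [/eqP->//|ys]; apply: (LE y).1 => //.
    exact: sub_Cone.
  move=> /allpairsP[[p q] /= []]; rewrite !mem_filter => /andP[pv pL] /andP[qv qL] ->.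
  rewrite dotBZl; case/orP: ys => [/eqP->|ys]; first by rewrite mulrC subrr.
  have y0 b : b \in L -> 0 <= dot b y by apply: (LE y).1; exact: sub_Cone.
  by rewrite addr_ge0 // -?mulNr mulr_ge0 ?y0 ?oppr_ge0 // ltW.
move=> xL.
have [t t_ge0 tL] : exists2 t, 0 <= t & forall a, a \in L -> t * dot a v <= dot a x.
  have pos a t : 0 < dot a v -> t <= dot a x / dot a v -> t * dot a v <= dot a x.
    by move=> av; rewrite ler_pdivlMr.
  have av0 a : a \in L -> dot a v = 0 -> 0 <= dot a x.
    by move=> aL e; apply: xL; rewrite mem_cat mem_filter aL e lexx.
  have avp a : a \in L -> 0 < dot a v -> 0 <= dot a x.
    by move=> aL av; apply: xL; rewrite mem_cat mem_filter aL ltW.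
  pose neg := [seq q <- L | dot q v < 0].
  have [neg0|negN] := eqVneq neg [::].
    exists 0 => // a aL; rewrite mul0r; have [av|av|//] := ltgtP (dot a v) 0.
    - have : a \in neg by rewrite mem_filter av.
      by rewrite neg0.
    - exact: avp.
    - exact: av0.
  have [q qneg qmin] := argmin_seq (fun q => - (dot q x / dot q v)) negN.
  have := qneg; rewrite mem_filter => /andP[qv qL].
  exists (Num.max 0 (dot q x / dot q v)); first by rewrite le_max lexx.
  move=> a aL; have [av|av|av] := ltgtP (dot a v) 0.
  - rewrite -ler_ndivrMr // le_max; apply/orP; right.
    by rewrite -lerN2; apply: qmin; rewrite mem_filter av.
  - apply: pos => //; rewrite ge_max divr_ge0 ?avp ?(ltW av) //=.
    rewrite (ler_pdivlMr _ _ av) mulrAC (ler_ndivrMr _ _ qv) -subr_ge0.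
    rewrite [X in X - _]mulrC [X in _ - X]mulrC -dotBZl.
    apply: xL; rewrite mem_cat; apply/orP; right; apply/allpairsP; exists (a, q).
    by rewrite /= !mem_filter av aL qv qL.
  - by rewrite av mulr0 av0.
have y0 : Cone [set` s] (x - t *: v).
  by apply/LE => a aL; rewrite dotBr dotZr subr_ge0 tL.
have [_ CD CZ] := convex_cone_Cone [set` v :: s].
rewrite -(subrK (t *: v) x); apply: (CD (x - t *: v)).
  move: (x - t *: v) y0; apply: Cone_min; first exact: convex_cone_Cone.
  by move=> y ys; apply: sub_Cone; rewrite /= inE [y \in s]ys orbT.
by apply: CZ => //; apply: sub_Cone; rewrite /= inE eqxx.
Qed.

Lemma clear_denominators (a : 'cV[rat]_n) :
  exists (d : rat) (w : 'cV[int]_n), d != 0 /\ map_mx intr w = d *: a.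
Proof.
exists (\prod_i denq (a i 0))%:~R.
exists (\col_i (numq (a i 0) * \prod_(j | j != i) denq (a j 0))); split.
  by rewrite intr_eq0; apply/prodf_neq0 => i _; exact: denq_neq0.
apply/colP => i; rewrite !mxE [in RHS](bigD1 i) //= !rmorphM /= numqE.
by rewrite -mulrA mulrC.
Qed.

(** Either the rational generators of the span have full rank, and keep it over
    the reals, or a rational vector is orthogonal to all of them. *)
Lemma rational_span_dichotomy (C : set V) : rational_subspace (lin_span C) ->
  (exists2 a : 'cV[int]_n, a != 0 & forall x, C x -> dot x (of_int R a^T) = 0) \/
  (forall b, (forall x, C x -> dot b x = 0) -> b = 0).
Proof.
move=> [s sE]; pose A : 'M[rat]_(size s, n) := \matrix_i s`_i.
have sC u : u \in s -> lin_span C (of_rat R u).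
  by move=> us; rewrite sE /=; apply: memv_span; exact: map_f.
have [/row_fullP[B BA]|nfull] := boolP (row_full A).
  right=> b b0; have Ab : map_mx ratr A *m b^T = 0.
    apply/colP => i; rewrite [RHS]mxE -[LHS](_ : dot (of_rat R s`_i) b = _).
      by rewrite dotC; apply: (lin_span_dot0 b0); apply: sC; exact: mem_nth.
    by rewrite /dot !mxE; apply: eq_bigr => j _; rewrite !mxE.
  apply: trmx_inj; rewrite trmx0 -[LHS]mul1mx -(map_mx1 (ratr : rat -> R)) -BA map_mxM.
  by rewrite -mulmxA Ab mulmx0.
left; have : cokermx A != 0.
  by rewrite -mxrank_eq0 mxrank_coker subn_eq0 -ltnNge ltn_neqAle rank_leq_col andbT.
move=> /matrix0Pn[k [j kj]].
have [d [w [d0 wE]]] := clear_denominators (col j (cokermx A)).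
have Aw : A *m map_mx intr w = 0.
  by rewrite wE -scalemxAr colE mulmxA mulmx_coker mul0mx scaler0.
exists w.
  apply: contraNneq kj => w0; have /colP/(_ k)/eqP := wE.
  by rewrite w0 !mxE eq_sym mulf_eq0 (negbTE d0).
move=> x Cx; rewrite dotC.
have : [set` <<map (@of_rat R n) s>>%VS] x by rewrite -sE; exact: sub_gen_smallest.
rewrite -lin_span_Cone; apply: lin_span_dot0 => y ys; apply/eqP.
have : Cone [set` map (@of_rat R n) s] `<=` [set y | dot (of_int R w^T) y == 0].
  apply: Cone_min => [|_ /= /mapP[u us ->]].
    split=> [|y1 y2 /= /eqP y10 /eqP y20|t y1 /= t0 /eqP y10]; rewrite /= ?dot0r ?dotDr ?dotZr //.
      by rewrite y10 y20 addr0.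
    by rewrite y10 mulr0.
  have /colP/(_ (Ordinal (etrans (index_mem u s) us))) := Aw.
  rewrite !mxE => /(congr1 (ratr : rat -> R)); rewrite rmorph0 => <-.
  rewrite rmorph_sum; apply/eqP; apply: eq_bigr => i _.
  by rewrite !mxE rmorphM /= nth_index // ratr_int mulrC.
exact.
Qed.

(** The interior of a unimodular cone that no lower dimensional cone of the fan
    crosses is covered by full dimensional cones meeting only outside it, each
    closed and open in it; hence by a single one. *)
Lemma cone_in_fan (Sigma : set (set V)) :
  is_fan Sigma -> complete_fan Sigma -> rational_fan Sigma ->
  exists L : seq 'cV[int]_n, forall P : chart n, P.1 \in unitmx ->
    (forall a, a \in L -> respects a [:: P]) ->
    exists2 C, Sigma C & cone P `<=` C.
Proof.
move=> [/finite_seqP[s sE] poly0 face0 cap0] complete rational.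
pose thin (C : set V) (a : 'cV[int]_n) := a != 0 /\ forall x, C x -> dot x (of_int R a^T) = 0.
pose f (C : set V) : 'cV[int]_n :=
  if pselect (exists a, thin C a) is left ex then projT1 (cid ex) else 0.
have fP C a : thin C a -> thin C (f C).
  by rewrite /f; case: pselect => [ex _|no ?]; [exact: projT2 (cid ex)|case: no; exists a].
have sS C : Sigma C <-> C \in s by rewrite sE.
exists (map f s) => P Pu res; have Gu := (gmx_inv R Pu).1.
pose inner (x : V) := forall i, 0 < crd (gmx R P) x i.
have inner_thin z C a : inner z -> Sigma C -> C z -> thin C a -> False.
  move=> zi SC Cz /fP[fC0 fC].
  have := fC z Cz; rewrite dotC (dot_crd _ _ Gu).
  have rowE i : dot (of_int R (f C)^T) (row i (gmx R P)) = (ev (row i P.1) (f C))%:~R.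
    by rewrite dotC -of_int_row dot_of_int trmxK.
  under eq_bigr do rewrite rowE.
  move=> sum0; case/eqP: fC0.
  rewrite -[f C](mulKmx Pu) (_ : P.1 *m f C = 0) ?mulmx0 //; apply/colP => i.
  have -> : (P.1 *m f C) i 0 = ev (row i P.1) (f C) by rewrite /ev -row_mul !mxE.
  rewrite mxE; apply/eqP; rewrite -(intr_eq0 R).
  have fCs : f C \in map f s by apply: map_f; rewrite -sS.
  have crd0 : crd (gmx R P) z i != 0 by rewrite gt_eqF.
  have [sgn|sgn] := res _ fCs P (mem_head _ _).
    have := psumr_eq0P (P := xpredT) _ sum0 => /(_ _ i isT)/eqP.
    rewrite mulf_eq0 (negbTE crd0); apply=> k _.
    by rewrite mulr_ge0 ?ler0z // ltW.
  have sumN0 : \sum_k crd (gmx R P) z k * - (ev (row k P.1) (f C))%:~R = 0.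
    by under eq_bigr do rewrite mulrN; rewrite sumrN sum0 oppr0.
  have := psumr_eq0P (P := xpredT) _ sumN0 => /(_ _ i isT)/eqP.
  rewrite mulf_eq0 (negbTE crd0) oppr_eq0; apply=> k _.
  by rewrite mulr_ge0 ?oppr_ge0 ?lerz0 // ltW.
have cover x : exists2 D, Sigma D & D x.
  have : [set: V] x by []. by rewrite -complete => -[D]; exists D.
have [Lf LE] : exists Lf : set V -> seq V, forall C, Sigma C ->
    forall x, C x <-> forall a, a \in Lf C -> 0 <= dot a x.
  exists (fun C => if pselect (Sigma C) is left SC
    then projT1 (cid (polyhedral_cone_ineqs (poly0 C SC))) else [::]).
  move=> C SC; case: pselect => // SC'.
  exact: (projT2 (cid (polyhedral_cone_ineqs (poly0 C SC')))).
have open C z d : Sigma C -> C z -> inner z ->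
    exists N, forall k, (N <= k)%N -> C (k%:R *: z + d).
  move=> SC Cz zi.
  have [N NP] : exists N, forall k, (N <= k)%N ->
      forall D, D \in s -> D (k%:R *: z + d) -> D z.
    apply: all_large => D /sS SD; have [Dz|nDz] := pselect (D z); first by exists 0%N.
    have [a /not_implyP[aL /negP]] : exists a, ~ (a \in Lf D -> 0 <= dot a z).
      by apply/existsNP => ?; apply/nDz/(LE D SD).
    rewrite -ltNge => az; have [N NP] := affine_lt0 (dot a d) az.
    exists N => k /NP; rewrite -dotZr -dotDr ltNge => /negP h /(LE D SD)/(_ a aL)//.
  exists N => k Nk; have [D SD Dk] := cover (k%:R *: z + d).
  have Dz : D z by apply: (NP k Nk) => //; rewrite -sS.
  have [CDC CDD] := cap0 C D SC SD.
  have SCD : Sigma (C `&` D) := face0 _ _ SC CDC.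
  have [[a a0 aC]|full] := rational_span_dichotomy (rational _ SCD).
    by case: (inner_thin z (C `&` D) a).
  have [a [_ aE]] := CDC; have [b [_ bE]] := CDD.
  have a0 : a = 0 by apply: full => x; rewrite aE => -[].
  have b0 : b = 0 by apply: full => x; rewrite bE => -[].
  have DC x : D x -> C x.
    move=> Dx; suff : (C `&` D) x by case.
    by rewrite bE; split=> //=; rewrite b0 dotC dot0r.
  exact: DC.
pose x0 : V := \sum_i (const_mx 1 : V) 0 i *: row i (gmx R P).
have x0i : inner x0 by move=> i; rewrite crd_comb // mxE.
have [C SC Cx0] := cover x0; exists C => //.
have innerC y : inner y -> C y.
  move=> yi; apply/(LE C SC) => a aL; rewrite leNgt; apply/negP => ay.
  pose neg := [seq b <- Lf C | dot b y < 0].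
  have aneg : a \in neg by rewrite mem_filter ay.
  have negN : neg != [::] by case: neg aneg.
  have [b bneg bmin] := argmin_seq (fun b => dot b x0 / - dot b y) negN.
  have := bneg; rewrite mem_filter => /andP[b_y bL] {a aL ay aneg}.
  have x0_ge0 c : c \in Lf C -> 0 <= dot c x0 by exact: (LE C SC x0).1.
  (* The last point of C on the segment from x0 to y, up to a positive factor. *)
  pose z := dot b x0 *: y + (- dot b y) *: x0.
  have zi : inner z.
    move=> i; rewrite crdD !crdZ ltr_wpDl //.
      by rewrite mulr_ge0 ?x0_ge0 // ltW.
    by rewrite mulr_gt0 ?oppr_gt0.
  have Cz : C z.
    apply/(LE C SC) => c cL; rewrite dotDr !dotZr.
    have [cy|cy] := leP 0 (dot c y).
      by rewrite addr_ge0 // mulr_ge0 ?x0_ge0 // oppr_ge0 ltW.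
    have := bmin c; rewrite mem_filter cy cL => /(_ isT).
    by rewrite ler_pdivrMr ?oppr_gt0 // mulrAC ler_pdivlMr ?oppr_gt0 //; lra.
  have [N NP] := open C z (y - x0) SC Cz zi.
  have := (LE C SC _).1 (NP N (leqnn N)) b bL.
  rewrite dotDr dotZr dotBr dotDr !dotZr.
  have -> : dot b x0 * dot b y + - dot b y * dot b x0 = 0 by ring.
  by have := x0_ge0 b bL; move: b_y; rewrite mulr0; lra.
move=> x /coneP Px; apply/(LE C SC) => a aL; rewrite leNgt; apply/negP => ax.
have [N NP] := affine_lt0 (dot a x0) ax.
have := NP N (leqnn N); rewrite -dotZr -dotDr ltNge => /negP; apply.
apply: (LE C SC _).1 => //; apply: innerC => i.
by rewrite crdD crdZ ltr_wpDl // mulr_ge0.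
Qed.

End Hyperplanes.

Theorem theorem2p26 (R : realType) (Sigma : set (set 'rV[R]_3)) :
  is_fan Sigma -> complete_fan Sigma -> rational_fan Sigma ->
  (exists Sigma' : set (set 'rV[R]_3),
     [/\ is_fan Sigma', complete_fan Sigma', unimodular_fan Sigma',
         refines Sigma' Sigma
       & ~ exists Sigma0 : set (set 'rV[R]_3),
             [/\ is_fan Sigma0, unimodular_fan Sigma0
               & is_blowup Sigma' Sigma0]])
  /\
  (polytopal Sigma ->
   exists Sigma' : set (set 'rV[R]_3),
     [/\ is_fan Sigma', complete_fan Sigma', unimodular_fan Sigma',
         refines Sigma' Sigma
       & ~ exists Sigma0 : set (set 'rV[R]_3),
             [/\ is_fan Sigma0, unimodular_fan Sigma0
               & is_blowup Sigma' Sigma0]]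
     /\ polytopal Sigma').
Proof.
move=> fanS completeS rationalS.
suff [Sigma' [good poly']] : exists Sigma' : set (set 'rV[R]_3),
     [/\ is_fan Sigma', complete_fan Sigma', unimodular_fan Sigma',
         refines Sigma' Sigma
       & ~ exists Sigma0 : set (set 'rV[R]_3),
             [/\ is_fan Sigma0, unimodular_fan Sigma0
               & is_blowup Sigma' Sigma0]]
     /\ polytopal Sigma'.
  by split=> [|_]; exists Sigma'.
have [L LP] := cone_in_fan fanS completeS rationalS.
have [T0 ok0] := orthants R 3.
pose coords : seq 'cV[int]_3 := [seq delta_mx c 0 | c <- enum 'I_3].
have [T1 [ok1 _ res1]] := respect_functionals (coords ++ L) ok0.
have coord1 c : respects (delta_mx c 0) T1.
  by apply: res1; rewrite mem_cat; apply/orP; left; apply/mapP; exists c; rewrite ?mem_enum.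
have [N Nc] := final_coherent ok1; pose T2 := refine N T1 final_pieces.
have [u1 c1 _] := ok1.
have u2 : unimodular T2 by apply: refine_unimodular => // P q; exact: final_unit.
have cov2 : covers R T2 by exact: final_covers.
exists (fan_of T2); split; last exact: polytopal_fan_of.
split.
- exact: is_fan_fan_of.
- exact: complete_fan_of.
- exact: unimodular_fan_of.
- move=> _ [P [I [PT ->]]]; have [Q QT PQ] := final_subdivides PT.
  have [C SC QC] : exists2 C, Sigma C & cone Q `<=` C.
    apply: LP; first exact: u1.
    move=> a aL S; rewrite inE => /eqP->; apply: (res1 a) => //.
    by rewrite mem_cat aL orbT.
  exists C; split=> // x /face_sub_cone Px; apply: QC.
  exact: inside_cone (u1 _ QT) (u2 _ PT) PQ _ Px.
- exact: (final_not_blowup ok1 coord1 Nc).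
Qed.
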